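(* Let $k \geq 2$ be an integer and let $G$ be a $(k+1)$-connected $(K_2 \cup kK_1)$-free graph with $\delta(G) \geq \frac{3k-1}{2}$ and $\alpha(G) < \frac{|V(G)|}{2}$. Then $G$ is hamiltonian-connected.
   Context: All graphs are finite, undirected and simple. $\delta(G)$ denotes the minimum degree and $\alpha(G)$ the independence number of $G$. For graphs $R, R'$, $R \cup R'$ is their disjoint union and $kR$ is the disjoint union of $k$ copies of $R$; $K_n$ is the complete graph on $n$ vertices. A graph $G$ is $R$-free if it contains no induced subgraph isomorphic to $R$. A graph $G$ is hamiltonian-connected if for every pair of distinct vertices $u,v$ of $G$ there is a path from $u$ to $v$ containing all vertices of $G$. *)

(* Defs.v *)
From mathcomp Require Import all_boot.
Set Implicit Arguments. Unset Strict Implicit. Unset Printing Implicit Defensive.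

Section Graphs.
Variable T : finType.

Definition simple_graph (e : rel T) : Prop := symmetric e /\ irreflexive e.

Definition deg (e : rel T) (x : T) : nat := #|[set y | e x y]|.

(* minimum degree delta(G) (meaningful for nonempty T; 0 if T empty) *)
Definition mindeg (e : rel T) : nat :=
  \big[minn/#|T|]_(x : T) deg e x.

Definition independent (e : rel T) (S : {set T}) : bool :=
  [forall x in S, forall y in S, ~~ e x y].

Definition alpha (e : rel T) : nat :=
  \max_(S : {set T} | independent e S) #|S|.

Definition connected_minus (e : rel T) (S : {set T}) : Prop :=
  forall x y, x \notin S -> y \notin S ->
    connect [rel a b | [&& e a b, a \notin S & b \notin S]] x y.

Definition k_connected (k : nat) (e : rel T) : Prop :=
  k < #|T| /\ forall S : {set T}, #|S| < k -> connected_minus e S.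

Definition has_induced_K2_kK1 (k : nat) (e : rel T) : Prop :=
  exists x y (I : {set T}),
    [/\ e x y, x \notin I, y \notin I, #|I| = k &
        (independent e I /\
         forall z, z \in I -> ~~ e x z /\ ~~ e y z)].

Definition K2_kK1_free (k : nat) (e : rel T) : Prop := ~ has_induced_K2_kK1 k e.

Definition hamiltonian_connected (e : rel T) : Prop :=
  forall u v : T, u != v ->
    exists p : seq T,
      [/\ path e u p, last u p = v, uniq (u :: p) & forall w, w \in u :: p].

End Graphs.

(* Main.v *)
Require Import Defs.
From mathcomp Require Import all_boot.
From mathcomp Require Import zify.
Set Implicit Arguments. Unset Strict Implicit. Unset Printing Implicit Defensive.

(* Add to the graph a new vertex w whose only neighbours are the two prescribed ends u, v;
   Hamiltonian u-v paths become Hamiltonian cycles through w.  Take a longest cycle c through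
   w and suppose that it misses x, with neighbourhood N.
   - Connectivity and freeness show that no edge avoids c.  The successors of N are
     independent, and so is the set I of vertices having no neighbour among them; every vertex
     outside I misses fewer than k vertices of I.  Let I' be the analogue for predecessors.
   - Crossing arguments show that two consecutive vertices z, z+ off N are never such that
     z, z+ are outside I and z is outside I'.  If I = I', then the vertices outside I are
     followed by vertices of I (or w), so I has at least half of the vertices.
   - Otherwise I and I' share fewer than k vertices, so some gap between consecutive
     neighbours of x runs from a vertex f outside I' to a vertex l outside I.  Such a gap
     cannot be inserted elsewhere on c, and counting the vertices of I missed by l and the
     vertices of I' missed by f gives a gap consisting of only two vertices f, l.
   - For a two-vertex gap, c can be rerouted through x so that f is the only vertex lost, and
     all but one of the new successors of the neighbours of f are missed by l.  This bounds
     the degree of f by k, or by k + 1 if f is adjacent to u and v, which contradicts the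
     minimum degree except in a configuration on five vertices. *)

Ltac is_arith b :=
  lazymatch b with
  | leq _ _ => idtac
  | @eq_op (Datatypes_nat__canonical__eqtype_Equality) _ _ => idtac
  | andb ?a ?b' => is_arith a; is_arith b'
  | orb ?a ?b' => is_arith a; is_arith b'
  | negb ?a => is_arith a
  end.

(* Clears the non-arithmetic boolean hypotheses, on which lia wastes its time, and
   unfolds the coercion that makes [size s] look different on a finite type. *)
Ltac slia :=
  repeat match goal with
  | H : is_true ?b |- _ => tryif is_arith b then fail else clear H
  end;
  repeat match goal with
  | H : context [Equality.sort (fintype_Finite__to__eqtype_Equality ?V)] |- _ =>
      progress change (Equality.sort (fintype_Finite__to__eqtype_Equality V))
        with (Finite.sort V) in H
  | |- context [Equality.sort (fintype_Finite__to__eqtype_Equality ?V)] =>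
      progress change (Equality.sort (fintype_Finite__to__eqtype_Equality V))
        with (Finite.sort V)
  end;
  repeat match goal with H : is_true (andb _ _) |- _ => case/andP: H => ? ? end;
  repeat match goal with |- is_true (andb _ _) => apply/andP; split end; lia.

(** * Paths as vertex lists with named ends *)

Section Segments.
Variables (V : finType) (e : rel V).

(** The list holds all vertices of the path, first one included, so that concatenation and reversal
    treat both ends alike and rerouted cycles can be assembled piece by piece. *)
Definition seg (a b : V) (s : seq V) : bool :=
  if s is y :: s' then [&& y == a, last y s' == b & path e y s'] else false.

Lemma seg1 a : seg a a [:: a].
Proof. by rewrite /= !eqxx. Qed.

Lemma seg_cat a b c d s t : seg a b s -> e b c -> seg c d t -> seg a d (s ++ t).
Proof.
case: s => [|y s] //= /and3P[/eqP-> /eqP lb pb] ebc.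
case: t => [|z t] //= /and3P[/eqP-> /eqP ld pd].
by rewrite eqxx last_cat cat_path /= lb ld eqxx ebc pb.
Qed.

Lemma seg_rev (e_sym : symmetric e) a b s : seg a b s -> seg b a (rev s).
Proof.
case: s => [|y s] //= /and3P[/eqP-> /eqP lb pb].
have : rev (a :: s) = b :: rev (belast a s) by rewrite lastI lb rev_rcons.
move=> ->; rewrite /= eqxx /=.
have -> : last b (rev (belast a s)) = a.
  by case: s lb {pb} => [|z s] //= _; rewrite rev_cons last_rcons.
rewrite eqxx -lb rev_path.
by rewrite (@eq_path _ _ e) // => x z; rewrite /= e_sym.
Qed.

Lemma seg_cycle a b s : seg a b s -> e b a -> cycle e s.
Proof.
case: s => [|y s] //= /and3P[/eqP-> /eqP lb pb] eba.
by rewrite rcons_path pb lb.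
Qed.

Lemma cycle_seg x0 s : cycle e s -> 0 < size s ->
  seg (nth x0 s 0) (nth x0 s (size s).-1) s /\ e (nth x0 s (size s).-1) (nth x0 s 0).
Proof.
case: s => [|y s] //=; rewrite rcons_path => /andP[p el] _.
have -> : nth x0 (y :: s) (size s) = last y s by rewrite nth_last.
by rewrite !eqxx p el.
Qed.

Lemma seg_cut x0 a b s i : seg a b s -> 0 < i < size s ->
  [/\ seg a (nth x0 s i.-1) (take i s), e (nth x0 s i.-1) (nth x0 s i)
   & seg (nth x0 s i) b (drop i s)].
Proof.
case: s => [|y s] //= /and3P[/eqP-> /eqP lb pb] {y}.
case: i => // i /=; rewrite ltnS => ltis.
move: pb lb; rewrite -{1 2}(cat_take_drop i s) cat_path last_cat => /andP[p1 p2] lb.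
have l1 : last a (take i s) = nth x0 (a :: s) i.
  rewrite -[last _ _]/(last x0 (take i.+1 (a :: s))) -nth_last size_take /= ltnS ltis /=.
  by rewrite -[a :: take i s]/(take i.+1 (a :: s)) nth_take.
move: p2 lb; rewrite (drop_nth x0 ltis) /= => /andP[e1 p2] lb.
by rewrite !eqxx p1 l1 eqxx /= lb eqxx p2 -l1 e1.
Qed.

End Segments.

(** * Exchange arguments on a longest cycle through [w] *)

Section LongestCycle.
Variables (V : finType) (e : rel V) (w : V).
Hypothesis e_sym : symmetric e.

(** The bound [2 < size c] is stated separately because a single edge, listed as two vertices,
    already satisfies [cycle]. *)
Definition maxcyc (c : seq V) : Prop :=
  [/\ uniq c, cycle e c, w \in c, 2 < size c
    & forall c', uniq c' -> cycle e c' -> w \in c' -> size c' <= size c].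

Lemma count_cut (p : pred V) i (s : seq V) :
  count p s = count p (take i s) + count p (drop i s).
Proof. by rewrite -count_cat cat_take_drop. Qed.

Lemma maxcyc_rot i c : maxcyc c -> maxcyc (rot i c).
Proof.
move=> [U C W S M]; split; rewrite ?rot_uniq ?rot_cycle ?mem_rot ?size_rot //.
Qed.

Lemma maxcyc_rev c : maxcyc c -> maxcyc (rev c).
Proof.
move=> [U C W S M]; split; rewrite ?rev_uniq ?mem_rev ?size_rev //.
by rewrite rev_cycle (@eq_cycle _ _ e) // => x y; rewrite /= e_sym.
Qed.

(** Every exchange below ends here: it exhibits a cycle on the vertices of [c] together with some
    new ones, which still passes through [w] and is longer. *)
Lemma no_extension c q c' : maxcyc c -> 0 < size q -> uniq q ->
  {in q, forall y, y \notin c} -> perm_eq c' (q ++ c) -> cycle e c' -> False.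
Proof.
move=> [U _ W _ M] q0 uq dq pq C.
have u' : uniq c'.
  rewrite (perm_uniq pq) cat_uniq uq U andbT /=.
  by apply/hasPn => y yc; apply/negP => yq; move: (dq _ yq); rewrite yc.
have : size c' <= size c by apply: M => //; rewrite (perm_mem pq) mem_cat W orbT.
by rewrite (perm_size pq) size_cat -[leqRHS]add0n leq_add2r leqNgt q0.
Qed.

Definition exterior (c q : seq V) : Prop :=
  uniq q /\ {in q, forall y, y \notin c}.

Lemma seg_size a b s : seg e a b s -> 0 < size s.
Proof. by case: s. Qed.

(** Otherwise [q] fits between the last and the first vertex of [c]. This and the following
    exchanges are all stated at that cut; rotations bring any other place of the cycle there. *)
Lemma no_insertion c q h1 h2 : maxcyc c -> exterior c q -> seg e h1 h2 q ->
  e h1 (nth w c (size c).-1) -> e h2 (nth w c 0) -> False.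
Proof.
move=> Mc [uq dq] sq e1 e2; have [U C W S M] := Mc.
have [|sc _] := @cycle_seg _ e w c C; first by slia.
apply: (@no_extension c q (q ++ c) Mc (seg_size sq) uq dq) => //.
by apply: (@seg_cycle _ _ h1 (nth w c (size c).-1)); [apply: seg_cat sq e2 sc | rewrite e_sym].
Qed.

(** The longer cycle follows [q], goes back from position [j.-1] to 0, jumps to [j] and runs on to
    the end. This is what makes successors of attached vertices independent. *)
Lemma no_cross_succ c q h1 h2 j : maxcyc c -> exterior c q -> seg e h1 h2 q ->
  e h1 (nth w c (size c).-1) -> 0 < j < size c -> e h2 (nth w c j.-1) ->
  e (nth w c 0) (nth w c j) -> False.
Proof.
move=> Mc [uq dq] sq e1 hj e2 e3; have [U C W S M] := Mc.
have [|sc _] := @cycle_seg _ e w c C; first by slia.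
have [s1 _ s2] := seg_cut w sc hj.
apply: (@no_extension c q (q ++ (rev (take j c) ++ drop j c)) Mc (seg_size sq) uq dq) => //.
  by apply/permP => p; rewrite !count_cat count_rev (count_cut p j c); slia.
apply: (@seg_cycle _ _ h1 (nth w c (size c).-1)); last by rewrite e_sym.
by apply: seg_cat sq e2 _; apply: seg_cat (seg_rev e_sym s1) e3 s2.
Qed.

Lemma exterior1 c x : x \notin c -> exterior c [:: x].
Proof. by move=> xc; split=> // y; rewrite inE => /eqP->. Qed.

(** The longer cycle visits [x], then positions [i.-1] down to 0, then [j] up to the end, then [i]
    up to [j.-1]. *)
Lemma no_double_cross c x i j : maxcyc c -> x \notin c -> 0 < i -> i < j < size c ->
  e x (nth w c i.-1) -> e x (nth w c j.-1) ->
  e (nth w c (size c).-1) (nth w c i) -> e (nth w c 0) (nth w c j) -> False.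
Proof.
move=> Mc /exterior1[uq dq] i0 hij e1 e2 e3 e4; have [U C W S M] := Mc.
have [|sc _] := @cycle_seg _ e w c C; first by slia.
have hj : 0 < j < size c by slia.
have [s1 _ s2] := seg_cut w sc hj.
have hi : 0 < i < size (take j c) by rewrite size_takel; slia.
have [t1 _ t2] := seg_cut w s1 hi.
rewrite !nth_take in t1 t2; try slia.
apply: (@no_extension c [:: x]
  ([:: x] ++ (rev (take i (take j c)) ++ (drop j c ++ drop i (take j c)))) Mc _ uq dq) => //.
  apply/permP => p; rewrite !count_cat count_rev (count_cut p j c).
  by rewrite (count_cut p i (take j c)); slia.
apply: (@seg_cycle _ _ x (nth w c j.-1)); last by rewrite e_sym.
apply: seg_cat (seg1 e x) e1 _; apply: seg_cat (seg_rev e_sym t1) e4 _.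
exact: seg_cat s2 e3 t2.
Qed.

(** The longer cycle visits [x], then positions [j.+1] up to the end, then [j] down to [i], then 0
    up to [i.-1]. *)
Lemma no_segment_move c x i j : maxcyc c -> x \notin c -> 0 < i <= j -> j.+1 < size c ->
  e x (nth w c i.-1) -> e x (nth w c j.+1) ->
  e (nth w c 0) (nth w c i) -> e (nth w c (size c).-1) (nth w c j) -> False.
Proof.
move=> Mc /exterior1[uq dq] hij jn e1 e2 e3 e4; have [U C W S M] := Mc.
have [|sc _] := @cycle_seg _ e w c C; first by slia.
have hj : 0 < j.+1 < size c by slia.
have [s1 _ s2] := seg_cut w sc hj.
have hi : 0 < i < size (take j.+1 c) by rewrite size_takel; slia.
have [t1 _ t2] := seg_cut w s1 hi.
rewrite !nth_take in t1 t2; try slia.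
apply: (@no_extension c [:: x]
  ([:: x] ++ (drop j.+1 c ++ (rev (drop i (take j.+1 c)) ++ take i (take j.+1 c))))
  Mc _ uq dq) => //.
  apply/permP => p; rewrite !count_cat count_rev (count_cut p j.+1 c).
  by rewrite (count_cut p i (take j.+1 c)); slia.
apply: (@seg_cycle _ _ x (nth w c i.-1)); last by rewrite e_sym.
apply: seg_cat (seg1 e x) e2 _; apply: seg_cat s2 e4 _.
apply: seg_cat (seg_rev e_sym t2) _ t1; by rewrite e_sym.
Qed.

(** Here [x] takes the place of the first [m] vertices, which are moved between positions [i] and
    [i.+1], reversed or not according to the disjunct. *)
Lemma no_gap_insertion c x m i : maxcyc c -> x \notin c -> 0 < m <= i -> i.+1 < size c ->
  e x (nth w c m) -> e x (nth w c (size c).-1) ->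
  (e (nth w c 0) (nth w c i) /\ e (nth w c m.-1) (nth w c i.+1)) \/
  (e (nth w c m.-1) (nth w c i) /\ e (nth w c 0) (nth w c i.+1)) -> False.
Proof.
move=> Mc /exterior1[uq dq] hmi hn e1 e2 H; have [U C W S M] := Mc.
have [|sc _] := @cycle_seg _ e w c C; first by slia.
have hj : 0 < i.+1 < size c by slia.
have [s1 _ s2] := seg_cut w sc hj.
have hi : 0 < m < size (take i.+1 c) by rewrite size_takel; slia.
have [t1 _ t2] := seg_cut w s1 hi.
rewrite !nth_take in t1 t2; try slia.
have pe g : perm_eq g (take m (take i.+1 c)) ->
  perm_eq ([:: x] ++ (drop m (take i.+1 c) ++ (g ++ drop i.+1 c))) ([:: x] ++ c).
  move=> /permP pg; apply/permP => p.
  rewrite !count_cat pg (count_cut p i.+1 c) (count_cut p m (take i.+1 c)); slia.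
case: H => [[e3 e4]|[e3 e4]].
  apply: (no_extension Mc _ uq dq (pe _ (perm_refl _))) => //.
  apply: (@seg_cycle _ _ x (nth w c (size c).-1)); last by rewrite e_sym.
  apply: seg_cat (seg1 e x) e1 _; apply: seg_cat t2 _ _; first by rewrite /= e_sym; exact: e3.
  exact: seg_cat t1 e4 s2.
apply: (no_extension Mc _ uq dq (pe (rev (take m (take i.+1 c))) _)) => //.
  by rewrite perm_rev.
apply: (@seg_cycle _ _ x (nth w c (size c).-1)); last by rewrite e_sym.
apply: seg_cat (seg1 e x) e1 _; apply: seg_cat t2 _ _; first by rewrite /= e_sym; exact: e3.
exact: seg_cat (seg_rev e_sym t1) e4 s2.
Qed.

End LongestCycle.

(** * Successors on a cycle and positions in its rotations *)

Section CyclicOrder.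
Variables (V : finType) (w : V).
Implicit Types (c : seq V) (y : V).

Lemma rot_last c y : uniq c -> y \in c ->
  exists i, nth w (rot i c) (size c).-1 = y.
Proof.
move=> U yc; exists (index y c).+1.
have lt : index y c < size c by rewrite index_mem.
rewrite /rot nth_cat size_drop ltnNge.
have -> : size c - (index y c).+1 <= (size c).-1 by slia.
rewrite nth_take /=; last by slia.
by rewrite (_ : _ - _ = index y c) ?nth_index //; slia.
Qed.

Lemma next_nth_succ c i : uniq c -> i.+1 < size c -> next c (nth w c i) = nth w c i.+1.
Proof.
move=> U lt; rewrite next_nth mem_nth ?(ltnW lt) // index_uniq ?(ltnW lt) //.
by case: c lt {U} => [|a c] //= lt; apply: set_nth_default.
Qed.

Lemma next_nth_last c : uniq c -> 0 < size c -> next c (nth w c (size c).-1) = nth w c 0.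
Proof.
move=> U lt; rewrite next_nth mem_nth ?index_uniq ?prednK //; last first.
by case: c lt {U} => [|a c] //= lt; rewrite nth_default.
Qed.

Lemma next_inj c : uniq c -> injective (next c).
Proof. by move=> U; apply: can_inj (prev_next U). Qed.

Lemma prev_inj c : uniq c -> injective (prev c).
Proof. by move=> U; apply: can_inj (next_prev U). Qed.

End CyclicOrder.

(** * Vertices missed by a longest cycle *)

Section Exterior.
Variables (V : finType) (e : rel V) (w : V) (k : nat).
Hypotheses (e_sym : symmetric e) (eirr : irreflexive e).

Definition nbh (x : V) : {set V} := [set y | e x y].

(** Only the graph away from [w] satisfies the assumptions of the theorem, so freeness and
    connectivity are restated for vertices and sets avoiding [w]. In [conn], the vertex [t] is what
    the outside neighbours of [H] separate from [H]. *)
Hypothesis degw : #|nbh w| <= 2.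
Hypothesis free : forall (y z : V) (J : {set V}), y != w -> z != w -> w \notin J ->
  e y z -> y \notin J -> z \notin J -> {in J &, forall a b, ~~ e a b} ->
  {in J, forall a, ~~ e y a /\ ~~ e z a} -> #|J| < k.
Hypothesis conn : forall H : {set V}, w \notin H -> H != set0 ->
  (exists t, [/\ t != w, t \notin H & {in H, forall h, ~~ e h t}]) ->
  k < #|[set t | [&& t \notin H, t != w & [exists h in H, e h t]]]|.

Notation maxcyc := (maxcyc e w).

Lemma next2_neq c y : maxcyc c -> y \in c -> next c (next c y) != y.
Proof.
move=> Mc yc; have [U C W S M] := Mc.
have [i Ey] := rot_last w U yc.
have {Mc} : maxcyc (rot i c) by apply: maxcyc_rot.
rewrite -!(next_rot i U); rewrite -(size_rot i c) in Ey.
move: (rot i c) Ey => {U C W S M yc}c' Ey [U C W S M].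
rewrite -Ey next_nth_last //; last by slia.
rewrite next_nth_succ //; last by slia.
by rewrite nth_uniq //; slia.
Qed.

Lemma next_neq c y : maxcyc c -> y \in c -> next c y != y.
Proof.
move=> Mc yc; apply/eqP => E; move: (next2_neq Mc yc).
by rewrite !E eqxx.
Qed.

(** The cycle already uses two distinct edges at [w], and the degree allows no more. *)
Lemma nbh_w c : maxcyc c -> nbh w = [set next c w; prev c w].
Proof.
move=> Mc; have [U C W S M] := Mc; apply/esym/eqP.
rewrite eqEcard subUset !sub1set !inE next_cycle //= e_sym prev_cycle //= cards2.
suff -> : next c w != prev c w by [].
apply/eqP => E; move: (next2_neq Mc W); rewrite E next_prev //.
by rewrite eqxx.
Qed.

(** Let [H] be the component of [y] off the cycle. Connectivity gives more than [k] attachments of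
    [H]; their successors are independent and not adjacent to [H], so together with an edge inside
    [H] they would form the forbidden subgraph. *)
Lemma exterior_independent c y z : maxcyc c -> y \notin c -> z \notin c -> ~~ e y z.
Proof.
move=> Mc yc zc; apply/negP => eyz; have [U C W S M] := Mc.
pose r := [rel a b | [&& e a b, a \notin c & b \notin c]].
pose H := [set t | connect r y t].
have rsym : connect_sym r.
  by apply: sym_connect_sym => a b /=; rewrite e_sym [(a \notin c) && _]andbC.
have yH : y \in H by rewrite inE connect0.
have Hc t : t \in H -> t \notin c.
  rewrite inE => /connectP[p pp ->]; elim: p y yc pp {eyz H yH} => //= a p IH b bc.
  by move=> /andP[/and3P[_ _ ac] pp]; apply: IH.
have Hcl h t : h \in H -> e h t -> t \notin c -> t \in H.
  move=> hH eht tc; move: (hH); rewrite !inE => /connect_trans; apply.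
  by apply: connect1; rewrite /= eht tc Hc.
have Hp h1 h2 : h1 \in H -> h2 \in H -> exists q, exterior c q /\ seg e h1 h2 q.
  move=> h1H h2H; have : connect r h1 h2.
    by move: h1H h2H; rewrite !inE rsym => a b; apply: connect_trans a b.
  move=> /connectP[p0 /shortenP[p pp up _] ->].
  exists (h1 :: p); split; last first.
    rewrite /= !eqxx /=; apply: sub_path pp => a b /=; by case/and3P.
  split=> // t; rewrite inE => /orP[/eqP->|]; first exact: Hc.
  move: pp; elim: p h1 {h1H up} => //= a p IH b /andP[/and3P[_ _ ac] pp].
  by rewrite inE => /orP[/eqP->//|]; apply: IH pp.
pose Att := [set t | [&& t \notin H, t != w & [exists h in H, e h t]]].
have Attc t : t \in Att -> t \in c.
  rewrite !inE -/H => /and3P[tH _ /existsP[h /andP[hH eht]]].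
  by apply: contraR tH => tc; rewrite -[connect _ _ _](in_set (connect r y)) (Hcl h).
have ins h1 h2 t : t \in c -> h1 \in H -> h2 \in H -> e h1 t -> e h2 (next c t) -> False.
  move=> tc h1H h2H e1 e2; have [q [xq sq]] := Hp _ _ h1H h2H.
  have [i Et] := rot_last w U tc.
  apply: (no_insertion e_sym (maxcyc_rot i Mc) (q := q) _ sq).
  - case: xq => uq dq; split=> // s sq'; rewrite mem_rot; exact: dq.
  - by rewrite size_rot Et.
  - by rewrite -next_nth_last ?rot_uniq ?size_rot ?next_rot ?Et //; slia.
have AttP t : t \in Att -> exists2 h, h \in H & e h t.
  by rewrite inE => /and3P[_ _ /existsP[h /andP[hH eht]]]; exists h.
have wH : w \notin H by apply/negP => /Hc; rewrite W.
have cAtt : k < #|Att|.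
  apply: conn => //; first by apply/set0Pn; exists y.
  (* [conn] needs a vertex separated from [H]. One of the two vertices following [w] serves, since
     [H] cannot be attached to consecutive vertices. *)
  have n1 : next c w != w by apply: next_neq.
  have n2 : next c (next c w) != w by apply: next2_neq.
  have [hA|no] := boolP [exists h in H, e h (next c w)].
    exists (next c (next c w)); split=> //.
      by apply/negP => /Hc; rewrite !mem_next W.
    move=> h' h'H; apply/negP => e2; move/existsP: hA => [h1 /andP[h1H e1]].
    by apply: (ins h1 h' (next c w)); rewrite ?mem_next.
  exists (next c w); split=> //; first by apply/negP => /Hc; rewrite mem_next W.
  by move=> h hH; apply: contra no => e1; apply/existsP; exists h; rewrite hH.
(* Discarding [w] costs at most one of the more than [k] successors, so [k] remain. *)
pose J := (next c @: Att) :\ w.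
have Jle : k <= #|J|.
  move: cAtt; rewrite -(card_imset _ (next_inj U)) (cardsD1 w (next c @: Att)) -/J.
  by case: (w \in _) => /=; slia.
have Jfree h a : h \in H -> a \in J -> ~~ e h a.
  move=> hH /setD1P[aw /imsetP[t tA Ea]]; apply/negP => e2; rewrite Ea in e2.
  by have [h1 h1H e1] := AttP _ tA; apply: (ins h1 h t) => //; apply: Attc.
have zH : z \in H by apply: Hcl eyz zc.
have JH a : a \in J -> a \notin H.
  move=> /setD1P[aw /imsetP[t tA Ea]]; apply/negP => /Hc; rewrite Ea mem_next.
  by rewrite Attc.
have := free (y := y) (z := z) (J := J); rewrite ltnNge Jle => F.
have {}F : ~ {in J &, forall a b, ~~ e a b}.
  move=> Ji; suff: false by [].
  apply: F => //.
  - by apply: contraNneq yc => ->.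
  - by apply: contraNneq zc => ->.
  - by rewrite !inE eqxx.
  - by apply/negP => /JH; rewrite yH.
  - by apply/negP => /JH; rewrite zH.
  - by move=> a aJ; rewrite !Jfree.
apply: F => _ _ /setD1P[_ /imsetP[t1 t1A ->]] /setD1P[_ /imsetP[t2 t2A ->]].
apply/negP => e12.
have [i Et] := rot_last w U (Attc _ t1A).
have [h1 h1H e1] := AttP _ t1A; have [h2 h2H e2] := AttP _ t2A.
have [q [xq sq]] := Hp _ _ h1H h2H.
have Ur : uniq (rot i c) by rewrite rot_uniq.
have Et0 : nth w (rot i c) 0 = next c t1.
  by rewrite -next_nth_last ?size_rot ?next_rot ?Et //; slia.
have t2r : t2 \in rot i c by rewrite mem_rot Attc.
have lt : index t2 (rot i c) < size c by rewrite -(size_rot i) index_mem.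
have ne : index t2 (rot i c) != (size c).-1.
  apply/eqP => E; move: Et; rewrite -E nth_index // => Et.
  by move: e12; rewrite Et eirr.
apply: (no_cross_succ e_sym (maxcyc_rot i Mc) (q := q) (j := (index t2 (rot i c)).+1) _ sq).
- case: xq => uq dq; split=> // s sq'; rewrite mem_rot; exact: dq.
- by rewrite size_rot Et.
- by rewrite size_rot; slia.
- by rewrite nth_index.
- rewrite -next_nth_succ ?nth_index ?next_rot ?Et0 //; rewrite size_rot; slia.
Qed.

Hypothesis k_ge2 : 2 <= k.
Hypothesis deg_ge : forall x, x != w -> 3 * k - 1 <= 2 * #|nbh x :\ w|.

Definition succs (c : seq V) (x : V) : {set V} := [set next c y | y in nbh x].

Definition real_succs (c : seq V) (x : V) : {set V} := succs c x :\ w.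

(** This is the set I of the overview; its analogue I' for predecessors is the same definition taken
    at [rev c]. *)
Definition indep_hull (c : seq V) (x : V) : {set V} :=
  [set v | (v != w) && [forall y in real_succs c x, ~~ e v y]].

(** * The hull of a missed vertex *)

Section Outsider.
Variables (c : seq V) (x : V).
Hypotheses (Mc : maxcyc c) (xc : x \notin c).

Notation N := (nbh x).
Notation S := (real_succs c x).
Notation I := (indep_hull c x).

Lemma uniq_maxcyc : uniq c. Proof. by case: Mc. Qed.
Lemma mem_w : w \in c. Proof. by case: Mc. Qed.
Local Notation U := uniq_maxcyc.

Lemma outsider_neq_w : x != w.
Proof. by apply: contraNneq xc => ->; apply: mem_w. Qed.

Lemma nbh_sub y : y \in N -> y \in c.
Proof. by rewrite inE => exy; apply: contraTT exy => yc; apply: exterior_independent Mc _ _. Qed.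

Lemma w_notin_nbh : w \notin N.
Proof.
rewrite inE e_sym; apply/negP => ewx; have : x \in nbh w by rewrite inE.
rewrite (nbh_w Mc) !inE => /orP[] /eqP E; move: xc; rewrite E.
  by rewrite mem_next mem_w.
by rewrite mem_prev mem_w.
Qed.

Lemma deg_outsider : 3 * k - 1 <= 2 * #|N|.
Proof.
have := deg_ge outsider_neq_w; rewrite (cardsD1 w N) (negbTE w_notin_nbh) /=.
by rewrite add0n.
Qed.

Lemma rot_at y : y \in c -> exists i, [/\ maxcyc (rot i c), x \notin rot i c,
  nth w (rot i c) (size (rot i c)).-1 = y & nth w (rot i c) 0 = next c y].
Proof.
move=> yc; have [i Ey] := rot_last w U yc; exists i.
have [_ _ _ sc _] := Mc.
split; rewrite ?mem_rot ?size_rot //; first exact: maxcyc_rot.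
rewrite -next_nth_last ?rot_uniq ?U ?size_rot //; last by slia.
by rewrite Ey next_rot ?U.
Qed.

Lemma nbh_next y : y \in N -> next c y \notin N.
Proof.
move=> yN; rewrite !inE; apply/negP => e2; have yc := nbh_sub yN.
have [i [Mi xi El E0]] := rot_at yc.
apply: (no_insertion e_sym Mi (exterior1 xi) (seg1 e x)); rewrite ?El ?E0 //.
by rewrite inE in yN.
Qed.

Lemma succs_independent : {in succs c x &, forall a b, ~~ e a b}.
Proof.
move=> _ _ /imsetP[y yN ->] /imsetP[z zN ->]; apply/negP => eyz.
have [i [Mi xi El E0]] := rot_at (nbh_sub yN).
have Ui : uniq (rot i c) by rewrite rot_uniq U.
have zi : z \in rot i c by rewrite mem_rot nbh_sub.
have lt : index z (rot i c) < size (rot i c) by rewrite index_mem.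
have ne : index z (rot i c) != (size (rot i c)).-1.
  apply/eqP => E; move: El; rewrite -E nth_index // => Ez.
  by move: eyz; rewrite Ez eirr.
apply: (no_cross_succ e_sym Mi (exterior1 xi) (j := (index z (rot i c)).+1) (seg1 e x)).
- by rewrite El; rewrite inE in yN.
- slia.
- by rewrite nth_index //; rewrite inE in zN.
- rewrite -next_nth_succ ?nth_index ?next_rot ?E0 ?U //; slia.
Qed.

Lemma card_real_succs : (w \in succs c x) + #|S| = #|N|.
Proof. by rewrite -cardsD1 card_imset //; apply: next_inj U. Qed.

(** At most one successor is [w], so twice the size is at least 3k - 3, which is at least 2k - 1
    since k is at least 2. *)
Lemma real_succs_ge : k <= #|S|.
Proof.
have := card_real_succs; have := deg_outsider; case: (w \in _) => /=; slia.
Qed.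

Lemma outsider_real_succs y : y \in S -> ~~ e x y.
Proof. by case/setD1P => _ /imsetP[z zN ->]; have := nbh_next zN; rewrite inE. Qed.

Lemma indep_hullP v : v != w -> (v \notin I) = [exists y in S, e v y].
Proof.
move=> vw; rewrite inE vw /= negb_forall; apply: eq_existsb => y.
by rewrite negb_imply negbK.
Qed.

Lemma real_succs_sub : S \subset I.
Proof.
apply/subsetP => y yS; rewrite inE; have [-> yS'] := setD1P yS.
apply/forall_inP => z /setD1P[_ zS]; exact: succs_independent.
Qed.

Lemma indep_hull_free v y : v \in I -> y \in S -> ~~ e v y.
Proof. by rewrite inE => /andP[_ /forall_inP]; apply. Qed.

Lemma indep_hull_neq_w v : v \in I -> v != w.
Proof. by rewrite inE => /andP[]. Qed.

Lemma w_notin_real_succs : w \notin S. Proof. by rewrite !inE eqxx. Qed.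

(** An edge inside the hull would be anticomplete to the independent set [S], which has at least [k]
    elements. *)
Lemma indep_hull_independent : {in I &, forall a b, ~~ e a b}.
Proof.
move=> a b aI bI; apply/negP => eab.
suff : #|S| < k by rewrite ltnNge real_succs_ge.
apply: (free (indep_hull_neq_w aI) (indep_hull_neq_w bI) w_notin_real_succs eab).
- by apply: contraTN eab => aS; rewrite e_sym indep_hull_free.
- by apply: contraTN eab => aS; rewrite indep_hull_free.
- by move=> y z yS zS; apply: indep_hull_free => //; apply: (subsetP real_succs_sub).
- by move=> y yS; rewrite !indep_hull_free.
Qed.

Lemma outsider_hull : x \in I.
Proof.
rewrite inE outsider_neq_w; apply/forall_inP => y; exact: outsider_real_succs.
Qed.

(** Outside the hull, [v] has a neighbour [y] in [S]. As [y] lies in the independent hull, freeness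
    applies to the edge from [v] to [y] and the hull vertices missed by [v]. *)
Lemma miss_lt v : v != w -> v \notin I -> #|I :\: nbh v| < k.
Proof.
move=> vw vI; move: (vI); rewrite indep_hullP // => /existsP[y /andP[yS evy]].
have yI := subsetP real_succs_sub _ yS.
have yw := indep_hull_neq_w yI.
have := free vw yw (J := I :\: nbh v); apply=> //.
- by apply/negP => /setDP[/indep_hull_neq_w]; rewrite eqxx.
- by rewrite inE (negbTE vI) andbF.
- by rewrite !inE evy.
- move=> a b /setDP[aI _] /setDP[bI _]; exact: indep_hull_independent.
- move=> a /setDP[aI]; rewrite inE => ->; split=> //; exact: indep_hull_independent.
Qed.

(** Otherwise both outsiders enter the cycle: [x], then back from [b] to the successor of [a], then
    [y], then from the successor of [b] on to [a]. *)
Lemma two_real_succs y : y \notin c -> y != x ->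
  {in N &, forall a b, a != b -> e y (next c a) -> e y (next c b) -> False}.
Proof.
move=> yc yx a b aN bN ab ea eb.
have [i [Mi xi El E0]] := rot_at (nbh_sub aN).
have Ui : uniq (rot i c) by rewrite rot_uniq U.
have bi : b \in rot i c by rewrite mem_rot nbh_sub.
have lt : index b (rot i c) < size (rot i c) by rewrite index_mem.
have ne : index b (rot i c) != (size (rot i c)).-1.
  by apply: contraNneq ab => E; rewrite -El -E nth_index.
set s := rot i c in Mi xi El E0 Ui bi lt ne.
have Eb : nth w s (index b s).+1 = next c b.
  by rewrite -next_nth_succ ?nth_index ?next_rot ?U //; slia.
have [_ C W Ss _] := Mi.
have [|sc _] := @cycle_seg _ e w s C; first by slia.
have [|s1 _ s2] := @seg_cut _ _ w _ _ s (index b s).+1 sc; first by slia.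
rewrite !E0 El Eb nth_index // in s1 s2.
move: aN bN; rewrite !inE => exa exb.
have yi : y \notin s by rewrite mem_rot.
clearbody s.
apply: (@no_extension _ e w s [:: x; y]
  ([:: x] ++ (rev (take (index b s).+1 s) ++ ([:: y] ++ drop (index b s).+1 s))) Mi) => //.
- by rewrite /= inE eq_sym yx.
- by move=> t; rewrite !inE => /orP[] /eqP->.
- by apply/permP => p; rewrite !count_cat count_rev (count_cut p (index b s).+1 s) /=; slia.
apply: (@seg_cycle _ _ x a); last by rewrite e_sym.
apply: seg_cat (seg1 e x) exb _; apply: seg_cat (seg_rev e_sym s1) _ _.
  by rewrite e_sym; exact: ea.
by apply: seg_cat (seg1 e y) eb s2.
Qed.

(** If [y] were adjacent to some [f] in [S], it would miss the rest of [S] by [two_real_succs]; then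
    the edge from [y] to [f] and the set [S] with [f] replaced by [x] contradict freeness. *)
Lemma exterior_hull y : y \notin c -> y \in I.
Proof.
move=> yc; have [->|yx] := eqVneq y x; first exact: outsider_hull.
have yw : y != w by apply: contraNneq yc => ->; apply: mem_w.
rewrite inE yw; apply/forall_inP => f fS; apply/negP => eyf.
have [fw /imsetP[a aN Ef]] := setD1P fS.
have fI := subsetP real_succs_sub _ fS.
have xS : x \notin S :\ f.
  by apply: contra xc => /setD1P[_ /setD1P[_ /imsetP[b bN ->]]]; rewrite mem_next nbh_sub.
have yS : y \notin S :\ f.
  by apply: contra yc => /setD1P[_ /setD1P[_ /imsetP[b bN ->]]]; rewrite mem_next nbh_sub.
have : #|x |: (S :\ f)| < k.
  apply: (free yw fw _ eyf).
  - by rewrite !inE !eqxx /= andbF orbF eq_sym outsider_neq_w.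
  - by rewrite in_setU1 (negbTE yx).
  - rewrite in_setU1 negb_or !inE eqxx andbT; apply: contraNneq xc => <-.
    by rewrite Ef mem_next nbh_sub.
  - move=> s t /setU1P sJ /setU1P tJ.
    have sI : s \in I.
      by case: sJ => [->|/setD1P[_ /(subsetP real_succs_sub)]//]; apply: outsider_hull.
    have tI : t \in I.
      by case: tJ => [->|/setD1P[_ /(subsetP real_succs_sub)]//]; apply: outsider_hull.
    exact: indep_hull_independent.
  - move=> s /setU1P[->|/setD1P[sf sS]].
      split; first by apply: exterior_independent Mc _ _.
      by apply: indep_hull_independent => //; apply: outsider_hull.
    split; last by apply: indep_hull_independent => //; apply: (subsetP real_succs_sub).
    have [_ /imsetP[b bN Es]] := setD1P sS; apply/negP => eys.
    rewrite Es in eys; rewrite Ef in eyf; apply: (two_real_succs yc yx aN bN _ eyf eys).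
    by apply: contraNneq sf => E; rewrite Es Ef E.
rewrite cardsU1 xS; have := real_succs_ge; rewrite (cardsD1 f S) fS; slia.
Qed.

End Outsider.

(** The bound [miss_lt] restated as a lower bound on the successors seen by [v]. The 2 comes from
    the strict inequality and from [x], itself a hull vertex missed by [v]. *)
Lemma miss_succs c x v : maxcyc c -> x \notin c -> v != w -> v \notin indep_hull c x ->
  ~~ e x v ->
  #|real_succs c x| + 2 <= #|[set a in nbh x | (next c a != w) && e v (next c a)]| + k.
Proof.
move=> Mc xc vw vI xv; have Uc : uniq c by case: Mc.
have := miss_lt Mc xc vw vI.
have sub : x |: (real_succs c x :\: nbh v) \subset indep_hull c x :\: nbh v.
  rewrite subUset sub1set in_setD outsider_hull // setSD ?real_succs_sub //.
  by rewrite inE e_sym xv.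
move/(leq_ltn_trans (subset_leq_card sub)); rewrite cardsU1.
have -> : x \notin real_succs c x :\: nbh v.
  apply: (contraNN _ xc) => /setDP[/setD1P[_ /imsetP[b bN ->]] _].
  by rewrite mem_next (nbh_sub Mc xc).
rewrite -(cardsID (nbh v) (real_succs c x)).
suff -> : real_succs c x :&: nbh v =
    next c @: [set a in nbh x | (next c a != w) && e v (next c a)].
  by rewrite card_imset; [slia | exact: next_inj].
apply/setP => y; apply/setIP/imsetP => [[/setD1P[yw /imsetP[a aN Ey]] evy]|[a]].
  by exists a => //; rewrite inE aN -Ey yw; rewrite inE in evy.
rewrite !inE => /and3P[aN aw ev] ->; rewrite aw ev; split=> //.
by apply/imsetP; exists a; rewrite ?inE.
Qed.

(** * Consecutive vertices avoiding the neighbourhood and the hulls *)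

Lemma succs_rot i c x : uniq c -> succs (rot i c) x = succs c x.
Proof. by move=> Uc; apply: eq_imset => y; rewrite next_rot. Qed.

Lemma hull_rot i c x : uniq c -> indep_hull (rot i c) x = indep_hull c x.
Proof. by move=> Uc; rewrite /indep_hull /real_succs succs_rot. Qed.

Lemma hull_rev_rot i c x : uniq c -> indep_hull (rev (rot i c)) x = indep_hull (rev c) x.
Proof. by move=> Uc; rewrite rev_rot /rotr hull_rot // rev_uniq. Qed.

Lemma next_index (c : seq V) (a : V) : uniq c -> a \in c -> (index a c).+1 < size c ->
  index (next c a) c = (index a c).+1.
Proof.
by move=> Uc ac lt; rewrite -{1}(nth_index w ac) next_nth_succ // index_uniq.
Qed.

Lemma prev_index (c : seq V) (a : V) : uniq c -> a \in c -> 0 < index a c ->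
  index (prev c a) c = (index a c).-1.
Proof.
move=> Uc ac i0; have lt : index a c < size c by rewrite index_mem.
have E : next c (nth w c (index a c).-1) = a.
  by rewrite next_nth_succ ?prednK ?nth_index.
by rewrite -{1}E prev_next // index_uniq //; slia.
Qed.

(* Positions are counted along the cycle from [next c z] to [z].  Writing D, A, B for the
   neighbours of x whose predecessor is adjacent to z, whose successor is adjacent to
   [next c z], and whose successor is adjacent to z, the two crossings force D <= A <= B,
   so that the three sets are almost disjoint, while each of them is too large for that. *)
Lemma no_free_edge_last c x (z := nth w c (size c).-1) (z' := nth w c 0) :
  maxcyc c -> x \notin c -> z != w -> z' != w -> z \notin nbh x -> z' \notin nbh x ->
  z \notin indep_hull c x -> z' \notin indep_hull c x -> z \notin indep_hull (rev c) x ->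
  False.
Proof.
move=> Mc xc zw z'w zN z'N zI z'I zI'.
have [Uc Cc Wc Sc _] := Mc.
have Mr := maxcyc_rev e_sym Mc.
have xr : x \notin rev c by rewrite mem_rev.
pose idx a := index a c.
have inc a : a \in nbh x -> a \in c by apply: nbh_sub.
have idxP a : a \in nbh x -> 0 < idx a < (size c).-1.
  move=> aN; have lt : idx a < size c by rewrite index_mem inc.
  have n0 : idx a != 0.
    by apply: (contraTneq _ aN) => E; rewrite -(nth_index w (inc _ aN)) -/(idx a) E.
  have n1 : idx a != (size c).-1.
    by apply: (contraTneq _ aN) => E; rewrite -(nth_index w (inc _ aN)) -/(idx a) E.
  slia.
have idx_inj : {in nbh x &, injective idx}.
  by move=> a b aN bN E; rewrite -(nth_index w (inc _ aN)) -/(idx a) E nth_index ?inc.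
have nthi a : a \in nbh x -> nth w c (idx a) = a by move=> aN; rewrite nth_index ?inc.
have nthn a : a \in nbh x -> nth w c (idx a).+1 = next c a.
  move=> aN; have := idxP _ aN => h.
  by rewrite -next_nth_succ ?nthi //; slia.
have nthp a : a \in nbh x -> nth w c (idx a).-1 = prev c a.
  move=> aN; have := idxP _ aN => h.
  apply: (next_inj Uc); rewrite next_prev // next_nth_succ //; last by slia.
  by rewrite prednK ?nthi //; slia.
have exP a : a \in nbh x -> e x a by rewrite inE.
pose A := [set a in nbh x | (next c a != w) && e z' (next c a)].
pose B := [set a in nbh x | (next c a != w) && e z (next c a)].
pose D := [set a in nbh x | (prev c a != w) && e z (prev c a)].
have AN a : a \in A -> a \in nbh x by rewrite inE => /and3P[].
have BN a : a \in B -> a \in nbh x by rewrite inE => /and3P[].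
have DN a : a \in D -> a \in nbh x by rewrite inE => /and3P[].
have Ae a : a \in A -> e z' (next c a) by rewrite inE => /and3P[].
have Be a : a \in B -> e z (next c a) by rewrite inE => /and3P[].
have De a : a \in D -> e z (prev c a) by rewrite inE => /and3P[].
have xz : ~~ e x z by rewrite inE in zN.
have xz' : ~~ e x z' by rewrite inE in z'N.
have cA := miss_succs Mc xc z'w z'I xz'; rewrite -/A in cA.
have cB := miss_succs Mc xc zw zI xz; rewrite -/B in cB.
have cD : #|real_succs (rev c) x| + 2 <= #|D| + k.
  have := miss_succs Mr xr zw zI' xz.
  rewrite (_ : [set a in _ | _] = D) //.
  by apply/setP => a; rewrite !inE next_rev.
have AB a b : a \in A -> b \in B -> idx a <= idx b.
  move=> aA bB; rewrite leqNgt; apply/negP => lt.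
  have ha := idxP _ (AN _ aA).
  apply: (no_double_cross e_sym Mc xc (i := (idx b).+1) (j := (idx a).+1)) => //.
  - slia.
  - by rewrite /= nthi ?exP ?BN.
  - by rewrite /= nthi ?exP ?AN.
  - by rewrite nthn ?Be ?BN.
  - by rewrite nthn ?Ae ?AN.
have DA d a : d \in D -> a \in A -> idx d <= idx a.
  move=> dD aA; rewrite leqNgt; apply/negP => lt.
  have hd := idxP _ (DN _ dD).
  have ne : idx d != (idx a).+1.
    apply/eqP => E; have := nbh_next Mc xc (AN _ aA).
    by rewrite -(nthn _ (AN _ aA)) -E (nthi _ (DN _ dD)) (DN _ dD).
  apply: (no_segment_move e_sym Mc xc (i := (idx a).+1) (j := (idx d).-1)) => //.
  - slia.
  - slia.
  - by rewrite /= nthi ?exP ?AN.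
  - by rewrite prednK ?nthi ?exP ?DN //; slia.
  - by rewrite nthn ?Ae ?AN.
  - by rewrite nthp ?De ?DN.
have rge := real_succs_ge Mc xc.
have rge' := real_succs_ge Mr xr.
have [d0 d0D] : exists d0, d0 \in D by apply/set0Pn; rewrite -card_gt0; slia.
have [a0 a0A] : exists a0, a0 \in A by apply/set0Pn; rewrite -card_gt0; slia.
have [d1 d1D dmax] : exists2 d1, d1 \in D & forall d, d \in D -> idx d <= idx d1.
  by case: (@arg_maxnP _ d0 (mem D) idx d0D) => d1 h1 h2; exists d1.
(* [L] and [R] share only [d1], and [A], [B] share at most one vertex, so the sizes of [D], [A] and
   [B] add up to at most two more than that of [nbh x]. *)
pose L := [set a in nbh x | idx a <= idx d1].
pose R := [set a in nbh x | idx d1 <= idx a].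
have LR : #|L| + #|R| <= #|nbh x| + 1.
  rewrite -cardsUI leq_add //.
    by apply: subset_leq_card; apply/subsetP => a /setUP[]; rewrite inE => /andP[].
  apply/card_le1_eqP => a b; rewrite !inE => /andP[/andP[aN a1] /andP[_ a2]].
  move=> /andP[/andP[bN b1] /andP[_ b2]].
  by apply: idx_inj; rewrite ?inE //; apply/eqP; slia.
have sDL : D \subset L.
  by apply/subsetP => d dD; rewrite inE DN // dmax.
have sABR : A :|: B \subset R.
  apply/subsetP => a /setUP[aA|aB]; rewrite inE.
    by rewrite AN // DA.
  by rewrite BN // (leq_trans (DA _ _ d1D a0A)) // AB.
have AB1 : #|A| + #|B| <= #|A :|: B| + 1.
  rewrite -cardsUI leq_add2l; apply/card_le1_eqP => a b /setIP[aA aB] /setIP[bA bB].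
  apply: idx_inj; rewrite ?AN //; apply/eqP.
  by rewrite eqn_leq !AB.
have lD := subset_leq_card sDL.
have lAB := subset_leq_card sABR.
have cS := card_real_succs x Mc; have cS' := card_real_succs x Mr.
have dx := deg_outsider Mc xc.
(* The count is contradictory unless both cycle neighbours of [w] are neighbours of [x]; in that
   case one further vertex is needed. *)
case w1: (w \in succs c x) in cS; case w2: (w \in succs (rev c) x) in cS'; rewrite /= in cS cS';
  try by slia.
have [v' v'N Ev'] := imsetP w1.
have [u' u'N Eu'] := imsetP w2; rewrite next_rev // in Eu'.
have wi : idx w = (idx v').+1.
  by rewrite /idx {1}Ev' next_index ?inc //; have := idxP _ v'N; rewrite /idx; slia.
have wi' : idx w = (idx u').-1.
  by rewrite /idx {1}Eu' prev_index ?inc //; have := idxP _ u'N; rewrite /idx; slia.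
have hu := idxP _ u'N.
have dw : idx d1 != idx w.
  apply: contraNneq (w_notin_nbh Mc xc) => E.
  by rewrite -(nth_index w Wc) -/(idx w) -E nthi ?DN.
have v'A : v' \notin A :|: B by rewrite !inE -Ev' eqxx /= !andbF.
have u'D : u' \notin D by rewrite !inE -Eu' eqxx /= !andbF.
(* The vertices [v'], [w], [u'] are consecutive and [d1] is not [w], so either [u'] lies in [L]
   outside [D], or [v'] lies in [R] outside [A] and [B]. *)
have [le|lt] := leqP (idx u') (idx d1).
  have : #|u' |: D| <= #|L|.
    by apply: subset_leq_card; rewrite subUset sub1set sDL inE u'N le.
  by rewrite cardsU1 u'D; slia.
have : #|v' |: (A :|: B)| <= #|R|.
  apply: subset_leq_card; rewrite subUset sub1set sABR inE v'N /=.
  by rewrite andbT; slia.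
by rewrite cardsU1 v'A; slia.
Qed.

Lemma no_free_edge c x z : maxcyc c -> x \notin c -> z \in c ->
  z != w -> next c z != w -> z \notin nbh x -> next c z \notin nbh x ->
  z \notin indep_hull c x -> next c z \notin indep_hull c x ->
  z \notin indep_hull (rev c) x -> False.
Proof.
move=> Mc xc zc; have [Uc _ _ _ _] := Mc.
have [i [Mi xi El E0]] := rot_at Mc xc zc.
rewrite -(hull_rot i x Uc) -(hull_rev_rot i x Uc) -E0 -El => *.
exact: (no_free_edge_last Mi xi).
Qed.

(** * A gap whose two ends lie outside opposite hulls *)

Hypothesis alpha : forall J : {set V}, w \notin J -> {in J &, forall a b, ~~ e a b} ->
  2 * #|J| < #|V|.-1.

Lemma hulls_differ c x : maxcyc c -> x \notin c -> indep_hull c x != indep_hull (rev c) x.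
Proof.
move=> Mc xc; apply/eqP => E; have [Uc _ Wc _ _] := Mc.
have Mr := maxcyc_rev e_sym Mc.
have xr : x \notin rev c by rewrite mem_rev.
set I := indep_hull c x in E.
have wI : w \notin I by rewrite inE eqxx.
have xI : x \in I by apply: outsider_hull.
(* With equal hulls, [next c] injects the complement of [I] without [w] into a set no larger than
   [I]: [x] is off the cycle and makes up for [w]. This contradicts [alpha]. *)
have step y : y \notin I -> y != w -> next c y \in w |: (I :\ x).
  move=> yI yw; rewrite in_setU1; case: (eqVneq (next c y) w) => //= ny.
  have yc : y \in c by apply: contraR yI => yc; apply: exterior_hull.
  rewrite in_setD1; have -> : next c y != x.
    by apply: (contraNneq _ xc) => <-; rewrite mem_next.
  apply: contraT => nI.
  have yN : y \notin nbh x.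
    apply: contra nI => yN; apply: (subsetP (real_succs_sub Mc xc)).
    by rewrite in_setD1 ny; apply/imsetP; exists y.
  have nN : next c y \notin nbh x.
    apply: contra yI => nN; rewrite E; apply: (subsetP (real_succs_sub Mr xr)).
    rewrite in_setD1 yw; apply/imsetP; exists (next c y) => //.
    by rewrite next_rev // prev_next.
  by exfalso; apply: (no_free_edge Mc xc yc) => //; rewrite -E.
have : #|(~: I) :\ w| <= #|w |: (I :\ x)|.
  rewrite -(card_imset _ (next_inj Uc)); apply: subset_leq_card.
  by apply/subsetP => _ /imsetP[y /setD1P[yw yI] ->]; apply: step; rewrite // inE in yI.
have := alpha wI (indep_hull_independent Mc xc).
have := cardsC I; rewrite (cardsD1 w (~: I)) inE wI cardsU1 (cardsD1 x I) xI in_setD1.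
by rewrite (negbTE wI) andbF /=; slia.
Qed.

(** Pigeonhole: the elements satisfying [n] bound [count n s - 1] gaps, more than there are elements
    satisfying [z]. *)
Lemma sparse_gap (n z : pred V) (s : seq V) : (count z s).+1 < count n s ->
  exists s1 a g b s2, [/\ s = s1 ++ a :: g ++ b :: s2, n a, n b, ~~ has n g & ~~ has z g].
Proof.
have [m] := ubnP (size s); elim: m s => // m IH [|y s] //= /ltnSE sm.
have [ny|ny] /= := boolP (n y); last first.
  rewrite add0n => lt; have [|s1 [a [g [b [s2 [-> na nb ng zg]]]]]] := IH s sm.
    by apply: leq_trans lt; rewrite !ltnS leq_addl.
  by exists (y :: s1), a, g, b, s2.
have [hs|hs] := boolP (has n s); last first.
  by move: hs; rewrite has_count -eqn0Ngt => /eqP->.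
have lt := hs; rewrite has_find in lt.
pose g := take (find n s) s; pose b := nth y s (find n s).
pose s2 := drop (find n s).+1 s.
have Es : s = g ++ b :: s2 by rewrite -drop_nth // cat_take_drop.
have nb : n b by apply: nth_find.
have ng : ~~ has n g.
  apply/negP => /(has_nthP y)[i]; rewrite size_takel ?(ltnW lt) // => li.
  by rewrite nth_take // before_find.
have [zg|zg] := boolP (has z g); last first.
  by move=> _; exists [::], y, g, b, s2; rewrite -Es.
have cg : count n g = 0 by apply/eqP; rewrite eqn0Ngt -has_count.
rewrite Es !count_cat cg => lt2; rewrite has_count in zg.
have [||s1 [a' [g' [b' [s2' [E na nb' ng' zg']]]]]] := IH (b :: s2).
- by apply: leq_trans sm; rewrite Es size_cat /= ltnS leq_addl.
- move: lt2 zg => /=; slia.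
by exists (y :: g ++ s1), a', g', b', s2'; rewrite E -?catA /= -?catA.
Qed.

(** The cycle is rotated so that the gap occupies the positions below [m], bounded by position [m]
    and the last one; [m.+1 < size c] keeps these two apart. *)
Definition is_gap (c : seq V) (x : V) (m : nat) : Prop :=
  [/\ 0 < m, m.+1 < size c, nth w c m \in nbh x, nth w c (size c).-1 \in nbh x
    & forall i, i < m -> nth w c i \notin nbh x].

Lemma exists_gap c x : maxcyc c -> x \notin c -> exists c' m,
  [/\ maxcyc c', x \notin c', next c' =1 next c, is_gap c' x m
    & [/\ nth w c' 0 != w, nth w c' m.-1 != w,
         nth w c' 0 \notin indep_hull (rev c') x & nth w c' m.-1 \notin indep_hull c' x]].
Proof.
move=> Mc xc; have [Uc _ Wc _ _] := Mc.
have Mr := maxcyc_rev e_sym Mc.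
have xr : x \notin rev c by rewrite mem_rev.
pose Z := indep_hull c x :&: indep_hull (rev c) x.
have cZ : #|Z| < k.
  have half d (Md : maxcyc d) (xd : x \notin d) v (J : {set V}) : v \in J -> v != w ->
      {in J &, forall a b, ~~ e a b} -> v \notin indep_hull d x ->
      #|J :&: indep_hull d x| < k.
    move=> vJ vw Ji vI; apply: leq_ltn_trans (miss_lt Md xd vw vI).
    apply: subset_leq_card; apply/subsetP => y /setIP[yJ yI].
    by rewrite in_setD yI inE (Ji v y).
  move: (hulls_differ Mc xc); rewrite eqEsubset negb_and.
  case/orP => /subsetPn[v v1 v2].
    exact: (half _ Mr xr v _ v1 (indep_hull_neq_w v1) (indep_hull_independent Mc xc) v2).
  rewrite /Z setIC.
  exact: (half _ Mc xc v _ v1 (indep_hull_neq_w v1) (indep_hull_independent Mr xr) v2).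
(* Cutting the cycle at [w] leaves a list [P] in which no gap contains [w]. *)
have [i P Ei] := rot_to Wc.
have Ui : uniq (w :: P) by rewrite -Ei rot_uniq.
have memP y : y \in P -> y \in c by move=> yP; rewrite -(mem_rot i c) Ei inE yP orbT.
have cN : count (mem (nbh x)) P = #|nbh x|.
  rewrite -(size_filter (mem (nbh x)) P) -(card_uniqP _); last first.
    by rewrite filter_uniq //; case/andP: Ui.
  apply: eq_card => y; rewrite mem_filter; apply/andP/idP => [[]//|yN]; split=> //.
  have := nbh_sub Mc xc yN; rewrite -(mem_rot i c) Ei inE.
  by case/orP => // /eqP yw; move: (w_notin_nbh Mc xc); rewrite -yw yN.
(* Strict because [x] belongs to both hulls but not to the cycle. *)
have cZP : count (mem Z) P < #|Z|.
  rewrite (cardsD1 x) inE !outsider_hull // ltnS -size_filter -(card_uniqP _); last first.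
    by rewrite filter_uniq //; case/andP: Ui.
  apply: subset_leq_card; apply/subsetP => y; rewrite mem_filter => /andP[yZ yP].
  rewrite in_setD1 [y \in Z]yZ andbT.
  by apply: (contraNneq _ xc) => <-; apply: memP.
have dx := deg_outsider Mc xc.
have [|s1 [a [g [b [s2 [EP na nb ng zg]]]]]] := @sparse_gap (mem (nbh x)) (mem Z) P.
  by rewrite cN; slia.
have {}na : a \in nbh x := na.
have {}nb : b \in nbh x := nb.
pose c' := g ++ (b :: s2 ++ w :: s1 ++ [:: a]).
have Ec' : c' = rot (size (w :: s1 ++ [:: a])) (rot i c).
  rewrite Ei EP (_ : w :: s1 ++ a :: g ++ b :: s2 = (w :: s1 ++ [:: a]) ++ (g ++ b :: s2)).
    by rewrite rot_size_cat /c' -!catA.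
  by rewrite /= -catA.
have Mc' : maxcyc c' by rewrite Ec'; do 2!apply: maxcyc_rot.
have xc' : x \notin c' by rewrite Ec' !mem_rot.
have nx : next c' =1 next c by move=> y; rewrite Ec' !next_rot // rot_uniq.
have hI : indep_hull c' x = indep_hull c x by rewrite Ec' !hull_rot // rot_uniq.
have hI' : indep_hull (rev c') x = indep_hull (rev c) x.
  by rewrite Ec' !hull_rev_rot // rot_uniq.
have [Uc' _ _ _ _] := Mc'.
have sc' : (size c').-1 = size g + (size s2 + (size s1).+2).
  by rewrite /c' size_cat /= size_cat /= size_cat /=; slia.
have El : nth w c' (size c').-1 = a.
  by rewrite nth_last /c' !(last_cat, last_cons).
have Eb : nth w c' (size g) = b by rewrite nth_cat ltnn subnn.
have g0 : 0 < size g.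
  rewrite lt0n; apply/eqP => g0.
  have Ea : next c' a = b.
    by rewrite -El next_nth_last //; [rewrite -g0 Eb | rewrite /c' size_cat /=; slia].
  by have := nbh_next Mc' xc' na; rewrite Ea nb.
have gap : is_gap c' x (size g).
  split=> //; rewrite ?El ?Eb //; first by rewrite -ltn_predRL sc'; slia.
  move=> j lj; rewrite nth_cat lj; apply: contraNN ng => h.
  by apply/hasP; exists (nth w g j) => //; apply: mem_nth.
have gw j : j < size g -> nth w c' j != w.
  move=> lj; rewrite nth_cat lj; apply: contraTneq Ui => Ew.
  have wg : w \in g by rewrite -Ew mem_nth.
  by rewrite /= EP mem_cat inE mem_cat wg !orbT.
have gZ j : j < size g -> nth w c' j \notin Z.
  move=> lj; rewrite nth_cat lj; apply: contraNN zg => h.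
  by apply/hasP; exists (nth w g j) => //; apply: mem_nth.
have Mr' := maxcyc_rev e_sym Mc'.
have xr' : x \notin rev c' by rewrite mem_rev.
exists c', (size g); split=> //; rewrite hI hI'; split; try by apply: gw; slia.
  (* The first vertex of the gap is a successor, hence in the first hull; avoiding [Z], it is
     outside the second. The last vertex is treated symmetrically. *)
  have := gZ 0 g0; rewrite inE negb_and => /orP[|//].
  suff -> : nth w c' 0 \in indep_hull c x by [].
  rewrite -hI; apply: (subsetP (real_succs_sub Mc' xc')); rewrite in_setD1 gw //.
  apply/imsetP; exists a => //.
  by rewrite -{1}El next_nth_last // size_cat; slia.
have l0 : (size g).-1 < size g by slia.
have := gZ _ l0; rewrite inE negb_and => /orP[//|].
suff -> : nth w c' (size g).-1 \in indep_hull (rev c) x by [].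
rewrite -hI'; apply: (subsetP (real_succs_sub Mr' xr')); rewrite in_setD1 gw //.
apply/imsetP; exists b => //; rewrite next_rev //; apply: (next_inj Uc').
rewrite next_prev // next_nth_succ // prednK ?Eb //.
by rewrite size_cat /=; slia.
Qed.

(** * Counting down to a gap of two vertices *)

Lemma is_gap_rev c x m : maxcyc c -> is_gap c x m ->
  let c' := rot (size (drop m c)) (rev c) in
  [/\ is_gap c' x m, nth w c' 0 = nth w c m.-1, nth w c' m.-1 = nth w c 0
    & nth w c' (size c').-1 = nth w c m].
Proof.
move=> Mc [m0 mn bN aN gN] c'; have Ec : c' = rev (take m c) ++ rev (drop m c).
  rewrite /c' -{2}(cat_take_drop m c) rev_cat -(size_rev (drop m c)).
  exact: rot_size_cat.
have sc : size c' = size c by rewrite size_rot size_rev.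
have st : size (take m c) = m by rewrite size_takel //; slia.
have sd : size (drop m c) = size c - m by rewrite size_drop.
have nl i : i < m -> nth w c' i = nth w c (m.-1 - i).
  move=> im; rewrite Ec nth_cat size_rev st im nth_rev st // nth_take; last by slia.
  by congr nth; slia.
have nr i : m <= i < size c -> nth w c' i = nth w c (size c + m - i.+1).
  move=> /andP[mi lti]; rewrite Ec nth_cat size_rev st ltnNge mi /= nth_rev sd; last by slia.
  by rewrite nth_drop; congr nth; slia.
have E0 : nth w c' 0 = nth w c m.-1 by rewrite nl // subn0.
have Em : nth w c' m.-1 = nth w c 0 by rewrite nl ?subnn //; slia.
have El : nth w c' (size c').-1 = nth w c m.
  by rewrite sc nr; [congr nth; slia | slia].
split=> //; split; rewrite ?El ?sc //.
  by rewrite nr; [rewrite (_ : _ - _ = (size c).-1) //; slia | slia].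
by move=> i im; rewrite nl //; apply: gN; slia.
Qed.

(** If [f] saw the second vertex after [a'], the gap could be inserted in reverse just before that
    vertex. If that vertex were outside the predecessor hull, then it and the vertex before it would
    contradict [no_free_edge] on the reversed cycle. *)
Lemma gap_next c x m a' (f := nth w c 0) (l := nth w c m.-1) :
  maxcyc c -> x \notin c -> is_gap c x m -> l != w ->
  a' \in nbh x -> a' != nth w c (size c).-1 -> next c a' != w -> next c (next c a') != w ->
  e l (next c a') -> next c (next c a') \in indep_hull (rev c) x :\: nbh f.
Proof.
move=> Mc xc [m0 mn bN aN gN] lw a'N a'a y_w z_w ely.
have [Uc _ _ Sc _] := Mc.
have Mr := maxcyc_rev e_sym Mc.
have xr : x \notin rev c by rewrite mem_rev.
have a'c := nbh_sub Mc xc a'N.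
have lt : index a' c < size c by rewrite index_mem.
have ge : m <= index a' c.
  rewrite leqNgt; apply/negP => lm; have := gN _ lm.
  by rewrite nth_index // a'N.
have ne : index a' c != (size c).-1.
  by apply: contraNneq a'a => <-; rewrite nth_index.
have Ey : nth w c (index a' c).+1 = next c a'.
  by rewrite -next_nth_succ ?nth_index //; slia.
have yN := nbh_next Mc xc a'N.
have ne' : (index a' c).+1 != (size c).-1.
  by apply: contraNneq yN => E; rewrite -Ey E.
have Ez : nth w c (index a' c).+2 = next c (next c a').
  by rewrite -next_nth_succ ?Ey //; slia.
set y := next c a' in y_w z_w ely Ey Ez yN *; set z := next c y in z_w Ez *.
have yc : y \in c by rewrite mem_next.
have yS : y \in real_succs c x by rewrite in_setD1 y_w; apply/imsetP; exists a'.
have Lprev : l \in indep_hull (rev c) x.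
  apply: (subsetP (real_succs_sub Mr xr)); rewrite in_setD1 lw.
  apply/imsetP; exists (nth w c m) => //; rewrite next_rev //.
  by apply: (next_inj Uc); rewrite next_prev // next_nth_succ ?prednK //; slia.
have yI' : y \notin indep_hull (rev c) x.
  by apply: contraTN ely => yI'; apply: indep_hull_independent Mr xr _ _ Lprev yI'.
have Ezy : next (rev c) z = y by rewrite next_rev // prev_next.
have zN : z \notin nbh x.
  apply: contra yI' => zN; apply: (subsetP (real_succs_sub Mr xr)).
  by rewrite in_setD1 y_w; apply/imsetP; exists z.
rewrite in_setD inE; apply/andP; split.
  apply/negP => efz.
  apply: (no_gap_insertion e_sym Mc xc (m := m) (i := (index a' c).+1)).
  - by slia.
  - by slia.
  - by rewrite inE in bN.
  - by rewrite inE in aN.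
  - by right; rewrite Ey Ez.
apply: contraT => zI'; exfalso.
apply: (no_free_edge Mr xr (z := z)); rewrite ?Ezy ?revK //.
  by rewrite mem_rev mem_next.
rewrite indep_hullP //; apply/existsP; exists y; rewrite yS /= e_sym.
by have [_ C _ _ _] := Mc; apply: next_cycle.
Qed.

Lemma card_inner_nbh c x a : maxcyc c -> x \notin c ->
  #|nbh x| <= #|[set y in nbh x | [&& y != a, next c y != w & next c (next c y) != w]]| + 2.
Proof.
move=> Mc xc; have [Uc _ _ _ _] := Mc.
(* Two consecutive vertices are never both neighbours of [x], so at most one of the two vertices
   before [w] is discarded, besides [a]. *)
pose q := if prev c w \in nbh x then prev c w else prev c (prev c w).
set N1 := finset _; have sub : nbh x \subset N1 :|: [set a; q].
  apply/subsetP => y yN; rewrite in_setU in_set yN /= in_set2.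
  case: (eqVneq y a) => //= ya; rewrite ?orbT //.
  have [E1|n1] /= := eqVneq (next c y) w.
    by rewrite /q -E1 prev_next // yN eqxx.
  have [E2|//] := eqVneq (next c (next c y)) w.
  rewrite /q -E2 prev_next // (negbTE (nbh_next Mc xc yN)) prev_next // eqxx.
  by rewrite orbT.
apply: leq_trans (subset_leq_card sub) _.
by rewrite (leq_trans (leq_card_setU _ _)) // leq_add2l cards2; case: (a != q).
Qed.

Lemma card_disjoint3 (A B M : {set V}) (x : V) : x \in M -> x \notin A -> x \notin B ->
  A \subset M -> B \subset M -> {in A, forall y, y \notin B} -> #|A| + #|B| + 1 <= #|M|.
Proof.
move=> xM xA xB sA sB AB.
have E : A :&: B = set0.
  by apply/setP => y; rewrite !inE; apply/negP => /andP[/AB/negP].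
have : #|x |: (A :|: B)| <= #|M|.
  by apply: subset_leq_card; rewrite !subUset sub1set xM sA.
rewrite cardsU1 in_setU negb_or xA xB -(addn0 #|A :|: B|).
by rewrite -[in X in _ + X](cards0 V) -E cardsUI addnC.
Qed.

Lemma exists_short_gap c x : maxcyc c -> x \notin c -> exists a,
  [/\ a \in nbh x, next c a != w, next c (next c a) != w
    & next c (next c (next c a)) \in nbh x].
Proof.
move=> Mc0 xc0.
have [c' [m [Mc xc nx gap [fw lw fI' lI]]]] := exists_gap Mc0 xc0.
suff [a [H1 H2 H3 H4]] : exists a,
    [/\ a \in nbh x, next c' a != w, next c' (next c' a) != w
      & next c' (next c' (next c' a)) \in nbh x] by exists a; rewrite -!nx.
move: c' Mc xc gap fw lw fI' lI {nx Mc0 xc0 c} => c Mc xc gap.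
set f := nth w c 0; set l := nth w c m.-1; move=> fw lw fI' lI.
case: (pickP [pred a | [&& a \in nbh x, next c a != w, next c (next c a) != w
    & next c (next c (next c a)) \in nbh x]]) => [a /and4P[? ? ? ?]|no]; first by exists a.
exfalso.
have [Uc _ _ Sc _] := Mc.
have Mr := maxcyc_rev e_sym Mc.
have xr : x \notin rev c by rewrite mem_rev.
(* Reversal exchanges [f] with [l] and [a] with [b], so the facts proved for successors transfer to
   predecessors. *)
have [gap' E0 Em El] := is_gap_rev Mc gap.
set c' := rot _ (rev c) in gap' E0 Em El.
have Mc' : maxcyc c' by apply: maxcyc_rot.
have xc' : x \notin c' by rewrite mem_rot.
have nx y : next c' y = prev c y by rewrite next_rot ?rev_uniq // next_rev.
have hI : indep_hull (rev c') x = indep_hull c x by rewrite hull_rev_rot ?rev_uniq // revK.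
have [m0 mn bN aN gN] := gap.
have fN : f \notin nbh x by apply: gN.
have lN : l \notin nbh x by apply: gN; slia.
have Mf : #|indep_hull (rev c) x :\: nbh f| < k by apply: miss_lt.
have Ml : #|indep_hull c x :\: nbh l| < k by apply: miss_lt.
set a := nth w c (size c).-1 in aN; set b := nth w c m in bN.
pose N1 := [set y in nbh x | [&& y != a, next c y != w & next c (next c y) != w]].
pose N2 := [set y in nbh x | [&& y != b, prev c y != w & prev c (prev c y) != w]].
have cN1 : #|nbh x| <= #|N1| + 2 by apply: card_inner_nbh.
have cN2 : #|nbh x| <= #|N2| + 2.
  have := card_inner_nbh b Mc' xc'.
  by rewrite (_ : [set y in _ | _] = N2) //; apply/setP => y; rewrite !inE !nx.
(* Each [y] in [N1] yields a missed hull vertex: its successor, missed by [l], or, if [l] sees that,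
   its second successor, missed by [f]. [N2] behaves dually. Without a two-vertex gap these do not
   collide, so by [miss_lt] the sizes of [N1] and [N2] sum to at most 2k - 4. *)
pose P1 := [set y | e l (next c y)]; pose P2 := [set y | e f (prev c y)].
have N1P y : y \in N1 -> [/\ y \in nbh x, y != a, next c y != w & next c (next c y) != w].
  by rewrite in_set => /and4P[].
have N2P y : y \in N2 -> [/\ y \in nbh x, y != b, prev c y != w & prev c (prev c y) != w].
  by rewrite in_set => /and4P[].
have disj y1 y2 : y1 \in N1 -> y2 \in N2 -> next c (next c (next c y1)) != y2.
  move=> /N1P[h1 _ h2 h3] /N2P[h4 _ _ _]; apply/eqP => E.
  by have /= := no y1; rewrite h1 h2 h3 E h4.
have xM d (h : V) (Md : maxcyc d) (xd : x \notin d) : h \notin nbh x ->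
    x \in indep_hull d x :\: nbh h.
  by rewrite in_setD outsider_hull // !inE e_sym => ->.
have c1 : #|N1 :\: P1| + #|N2 :&: P2| + 1 < k.
  apply: leq_ltn_trans Ml.
  rewrite -(card_imset (mem (N1 :\: P1)) (next_inj Uc)).
  rewrite -(card_imset (mem (N2 :&: P2)) (inj_comp (prev_inj Uc) (prev_inj Uc))).
  apply: card_disjoint3 (xM _ _ Mc xc lN) _ _ _ _ _.
  - apply: (contraNN _ xc) => /imsetP[y /setDP[/N1P[yN _ _ _] _] ->].
    by rewrite mem_next (nbh_sub Mc xc yN).
  - apply: (contraNN _ xc) => /imsetP[y /setIP[/N2P[yN _ _ _] _] ->] /=.
    by rewrite !mem_prev (nbh_sub Mc xc yN).
  - apply/subsetP => t /imsetP[y /setDP[/N1P[yN _ yw _]]]; rewrite inE => nl ->.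
    rewrite in_setD inE nl /=; apply: (subsetP (real_succs_sub Mc xc)).
    by rewrite in_setD1 yw; apply/imsetP; exists y.
  - apply/subsetP => t /imsetP[y /setIP[/N2P[yN yb yw y2w]]]; rewrite inE => efy ->.
    have := gap_next (a' := y) Mc' xc' gap'.
    by rewrite E0 Em El !nx hI; apply.
  - move=> _ /imsetP[y1 /setDP[y1N _] ->]; apply/negP.
    move=> /imsetP[y2 /setIP[y2N _] /= E].
    by have := disj _ _ y1N y2N; rewrite E !next_prev // eqxx.
have c2 : #|N2 :\: P2| + #|N1 :&: P1| + 1 < k.
  apply: leq_ltn_trans Mf.
  rewrite -(card_imset (mem (N2 :\: P2)) (prev_inj Uc)).
  rewrite -(card_imset (mem (N1 :&: P1)) (inj_comp (next_inj Uc) (next_inj Uc))).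
  apply: card_disjoint3 (xM _ _ Mr xr fN) _ _ _ _ _.
  - apply: (contraNN _ xc) => /imsetP[y /setDP[/N2P[yN _ _ _] _] ->].
    by rewrite mem_prev (nbh_sub Mc xc yN).
  - apply: (contraNN _ xc) => /imsetP[y /setIP[/N1P[yN _ _ _] _] ->] /=.
    by rewrite !mem_next (nbh_sub Mc xc yN).
  - apply/subsetP => t /imsetP[y /setDP[/N2P[yN _ yw _]]]; rewrite inE => nl ->.
    rewrite in_setD inE nl /=; apply: (subsetP (real_succs_sub Mr xr)).
    by rewrite in_setD1 yw; apply/imsetP; exists y; rewrite // next_rev.
  - apply/subsetP => t /imsetP[y /setIP[/N1P[yN ya yw y2w]]]; rewrite inE => ely ->.
    exact: (gap_next Mc xc gap).
  - move=> _ /imsetP[y2 /setDP[y2N _] ->]; apply/negP.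
    move=> /imsetP[y1 /setIP[y1N _] /= E].
    by have := disj _ _ y1N y2N; rewrite -E next_prev // eqxx.
have := deg_outsider Mc xc.
move: cN1 cN2; rewrite -(cardsID P1 N1) -(cardsID P2 N2); slia.
Qed.

Lemma next_cat (A B : seq V) y z : uniq (A ++ y :: z :: B) -> next (A ++ y :: z :: B) y = z.
Proof.
by move=> Us; rewrite -(next_rot (size A) Us) rot_size_cat /= eqxx.
Qed.

Lemma next_head_last (s : seq V) y z : uniq (z :: rcons s y) -> next (z :: rcons s y) y = z.
Proof.
by move=> Us; have := next_nth_last w Us isT; rewrite nth_last /= last_rcons.
Qed.

(** * Gaps of two vertices *)

Section ShortGap.
Variables (c : seq V) (x f l b : V) (r : seq V).
Hypotheses (Mc : maxcyc c) (xc : x \notin c).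
Hypothesis Ec : c = [:: f, l, b & r].
Hypotheses (fw : f != w) (lw : l != w) (bN : b \in nbh x) (aN : last b r \in nbh x).

Lemma short_gap_insertion p1 y z p2 : b :: r = p1 ++ y :: z :: p2 ->
  ~~ (e f y && e l z) /\ ~~ (e l y && e f z).
Proof.
move=> Er.
have Ey : nth w c (size p1).+2 = y by rewrite Ec Er /= nth_cat ltnn subnn.
have Ez : nth w c (size p1).+3 = z by rewrite Ec Er /= nth_cat ltnNge leqnSn subSnn.
have sc : (size p1).+3 < size c.
  by rewrite Ec /= -[(size r).+1]/(size (b :: r)) Er size_cat /=; slia.
have El : nth w c (size c).-1 = last b r by rewrite nth_last Ec.
split; apply/negP => /andP[e1 e2];
  apply: (no_gap_insertion e_sym Mc xc (m := 2) (i := (size p1).+2)) => //;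
  rewrite ?Ey ?Ez ?El ?Ec //=; try by [move: bN; rewrite inE | move: aN; rewrite inE].
  by left.
by right.
Qed.

Let Uc : uniq c. Proof. by case: Mc. Qed.

Lemma short_gap_next : [/\ next c f = l, next c l = b, next c (last b r) = f & last b r != b].
Proof.
have Uc' := Uc; rewrite Ec in Uc' *.
have ne : last b r != b.
  apply/eqP => E; have [_ _ + _ _] := Mc; rewrite Ec => wc.
  case: r E Uc' wc => [_ _|y s E]; last first.
    by rewrite /= -E (mem_last y s) /= !andbF.
  rewrite !inE (eq_sym w) (negbTE fw) (eq_sym w) (negbTE lw) => /eqP Eb.
  by move: (w_notin_nbh Mc xc); rewrite Eb bN.
split=> //.
- by rewrite (next_cat (A := [::])).
- by rewrite (next_cat (A := [:: f])).
move: Uc'; case/lastP: r ne => [|s y]; first by rewrite eqxx.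
by rewrite last_rcons => _; apply: (@next_head_last [:: l, b & s]).
Qed.

Lemma short_gap_edges : [/\ e f l, e l b & e (last b r) f].
Proof.
have [n1 n2 n3 _] := short_gap_next; have [_ C _ _ _] := Mc.
have nxt y : y \in c -> e y (next c y) by apply: next_cycle.
split; [rewrite -n1 | rewrite -n2 | rewrite -n3]; apply: nxt; rewrite Ec !in_cons ?eqxx ?orbT //.
by rewrite -in_cons mem_last !orbT.
Qed.

Lemma short_gap_hulls : [/\ f \in real_succs c x, l \in real_succs (rev c) x,
  f \notin indep_hull (rev c) x & l \notin indep_hull c x].
Proof.
have [n1 n2 n3 _] := short_gap_next; have [e1 _ _] := short_gap_edges.
have fS : f \in real_succs c x.
  by rewrite in_setD1 fw; apply/imsetP; exists (last b r).
have lS : l \in real_succs (rev c) x.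
  by rewrite in_setD1 lw; apply/imsetP; exists b; rewrite // next_rev // -n2 prev_next.
split=> //; rewrite indep_hullP //; apply/existsP.
  by exists l; rewrite lS.
by exists f; rewrite fS e_sym.
Qed.

Lemma short_gap_out : ~~ e x f /\ ~~ e x l.
Proof.
have Mr := maxcyc_rev e_sym Mc; have xr : x \notin rev c by rewrite mem_rev.
have [fS lS _ _] := short_gap_hulls.
by rewrite (outsider_real_succs Mc xc fS) (outsider_real_succs Mr xr lS).
Qed.

(** By [miss_succs], [l] is adjacent to the successors of at least two neighbours of [x], one of
    which is not the last vertex of the cycle. *)
Lemma short_gap_chord : exists a' f' r1 r2,
  [/\ b :: r = r1 ++ a' :: f' :: r2, e x a', f' != w & e l f'].
Proof.
have [n1 n2 n3 ab] := short_gap_next; have [xf xl] := short_gap_out.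
have [fS lS fI lI] := short_gap_hulls.
have := miss_succs Mc xc lw lI xl; have := real_succs_ge Mc xc.
set A := finset _; move=> h1 h2.
have [a' a'A a'a] : exists2 a', a' \in A & a' != last b r.
  have : 0 < #|A :\ last b r|.
    by move: h2; rewrite (cardsD1 (last b r) A); case: (_ \in A) => /=; slia.
  by case/card_gt0P => a' /setD1P[]; exists a'.
move: a'A; rewrite in_set => /and3P[a'N f'w elf].
have a'r : a' \in b :: r.
  have := nbh_sub Mc xc a'N; rewrite Ec !(in_cons f) !(in_cons l).
  case/or3P => // /eqP E; move: a'N; rewrite E inE.
    by rewrite (negbTE xf).
  by rewrite (negbTE xl).
have [r1 [r3 Er]] : exists r1 r3, b :: r = r1 ++ a' :: r3.
  by case/splitPr: a'r => p1 p2; exists p1, p2.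
case: r3 Er => [|f' r2] Er.
  move: a'a; suff -> : last b r = a' by rewrite eqxx.
  by rewrite -[last b r]/(last b (b :: r)) Er last_cat.
have Ef' : next c a' = f'.
  have Ec' : c = [:: f, l & r1] ++ a' :: f' :: r2 by rewrite Ec Er.
  by rewrite Ec' next_cat // -Ec'.
by exists a', f', r1, r2; rewrite Ef' in f'w elf; rewrite inE in a'N.
Qed.

(** * The cycle rerouted through [x] so as to lose only [f] *)

Section Rotated.
Variables (a' f' : V) (r1 r2 : seq V).
Hypotheses (Er : b :: r = r1 ++ a' :: f' :: r2) (xa' : e x a') (f'w : f' != w) (elf' : e l f').

Let L := l :: rcons r1 a'.
Let R := f' :: r2.
(** From [x] to [a'], back along the old cycle to [l], across the chord to [f'], and forward to the
    last vertex, a neighbour of [x]. *)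
Let c2 := x :: rev L ++ R.

Lemma rotated_split : c = f :: L ++ R.
Proof. by rewrite Ec Er /L /R /= cat_rcons. Qed.

Lemma rotated_maxcyc : maxcyc c2.
Proof.
have [U C W S M] := Mc; have [_ _ eaf] := short_gap_edges.
have pe : perm_eq c2 (x :: L ++ R).
  by rewrite /c2 perm_cons perm_cat2r perm_rev.
have UL : uniq (L ++ R) by move: U; rewrite rotated_split => /andP[].
have sc : size c2 = size c by rewrite (perm_size pe) rotated_split.
split; rewrite ?sc //.
- rewrite (perm_uniq pe) cons_uniq UL andbT; apply: (contraNN _ xc).
  by move=> xLR; rewrite rotated_split in_cons; apply/orP; right.
- have Ea : last f' r2 = last b r.
    by rewrite -[RHS]/(last b (b :: r)) Er last_cat.
  move: C; rewrite rotated_split -[cycle _ _]/(path e f (rcons (L ++ R) f)) rcons_path cat_path.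
  move=> /andP[/andP[/andP[_ p1] pR] _].
  have p2 : path e f' r2 by case/andP: pR.
  apply: (@seg_cycle _ _ x (last b r)); last by move: aN; rewrite inE e_sym.
  apply: (@seg_cat _ _ x x a' _ [:: x]); [exact: seg1|exact: xa'|].
  apply: (@seg_cat _ _ a' l f').
  + by apply: seg_rev => //=; rewrite last_rcons !eqxx.
  + exact: elf'.
  + by rewrite /= eqxx Ea eqxx.
- rewrite (perm_mem pe) in_cons; move: W; rewrite rotated_split in_cons.
  by rewrite (eq_sym w) (negbTE fw) orFb => ->; rewrite orbT.
Qed.

Lemma rotated_out : f \notin c2.
Proof.
have [xf _] := short_gap_out.
have := Uc; rewrite rotated_split cons_uniq => /andP[+ _].
rewrite mem_cat negb_or => /andP[fL fR].
rewrite /c2 in_cons negb_or mem_cat mem_rev negb_or fL fR !andbT.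
by apply: contraNneq xc => <-; rewrite rotated_split in_cons eqxx.
Qed.

Let U2 : uniq c2. Proof. by case: rotated_maxcyc. Qed.

Lemma rotated_f' : ~~ e f f'.
Proof.
have [fS _ _ _] := short_gap_hulls.
have f'S : f' \in real_succs c x.
  rewrite in_setD1 f'w; apply/imsetP; exists a'; first by rewrite inE.
  have := Uc; rewrite rotated_split /L /R -cats1 => U3.
  have Ecc : f :: (l :: r1 ++ [:: a']) ++ f' :: r2 = ([:: f, l & r1]) ++ a' :: f' :: r2.
    by rewrite /= -catA.
  by rewrite Ecc next_cat // -Ecc.
by apply: succs_independent Mc xc _ _ _ _; [case/setD1P: fS | case/setD1P: f'S].
Qed.

(** Adjacent vertices of [c2] are mostly adjacent on [c] too, and there [short_gap_insertion]
    forbids the edge to [l]. What remains are the places next to [x], which [l] misses, and those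
    around [l] and [f']. *)
Lemma rotated_neighbours y : y \in c2 -> e f y ->
  (next c2 y != f' -> ~~ e l (next c2 y)) /\ (prev c2 y != b -> ~~ e l (prev c2 y)).
Proof.
have [xf xl] := short_gap_out; have ins := @short_gap_insertion.
rewrite in_cons mem_cat mem_rev => /or3P[/eqP->|yL|yR] efy.
- by move: efy; rewrite e_sym (negbTE xf).
- have {yL} [p1 [p2 EL]] : exists p1 p2, L = p1 ++ y :: p2.
    by case/splitPr: yL => p1 p2; exists p1, p2.
  have Ec2 : c2 = (x :: rev p2) ++ y :: (rev p1 ++ f' :: r2).
    by rewrite /c2 EL rev_cat rev_cons cat_rcons -catA.
  split.
    case/lastP: p1 EL Ec2 => [|p1 s] EL Ec2.
      by rewrite {1}Ec2 next_cat ?eqxx -?Ec2.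
    rewrite rev_rcons in Ec2; rewrite Ec2 next_cat -?Ec2 // => _.
    case: p1 EL {Ec2} => [|q p1] EL; first by case: EL => <- _; rewrite eirr.
    case: EL => _ EL; have [|_ +] := ins p1 s y (p2 ++ f' :: r2).
      by rewrite Er -[a' :: f' :: r2]cat1s catA cats1 EL cat_rcons -catA.
    by rewrite efy andbT.
  case: p2 EL Ec2 => [|s p2] EL Ec2.
    suff -> : prev c2 y = x by rewrite e_sym.
    apply: (next_inj U2); rewrite next_prev //; apply/esym.
    by move: U2; rewrite Ec2 => U3; exact: (next_cat (A := [::]) U3).
  have -> : prev c2 y = s.
    apply: (next_inj U2); rewrite next_prev // Ec2 rev_cons -rcons_cons cat_rcons.
    by rewrite next_cat // -cat_rcons rcons_cons -rev_cons -Ec2.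
  case: p1 EL {Ec2} => [|q p1] EL.
    case: EL => _ EL; move: Er; rewrite -[a' :: f' :: r2]cat1s catA cats1 EL /= => -[-> _].
    by rewrite eqxx.
  move=> _; case: EL => _ EL; have [|+ _] := ins p1 y s (p2 ++ f' :: r2).
    by rewrite Er -[a' :: f' :: r2]cat1s catA cats1 EL -catA.
  by rewrite efy.
have {yR} [p1 [p2 ER]] : exists p1 p2, R = p1 ++ y :: p2.
  by case/splitPr: yR => p1 p2; exists p1, p2.
have Ec2 : c2 = (x :: rev L ++ p1) ++ y :: p2 by rewrite /c2 ER /= -catA.
have Er' : b :: r = (rcons r1 a' ++ p1) ++ y :: p2.
  by rewrite Er -catA -ER -cat_rcons.
split.
  case: p2 ER Ec2 Er' => [|s p2] ER Ec2 Er'.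
    suff -> : next c2 y = x by rewrite e_sym.
    by move: U2; rewrite Ec2 cats1 => U3; apply: next_head_last.
  have [+ _] := ins _ _ _ _ Er'; rewrite efy Ec2 next_cat // -?Ec2 //.
case/lastP: p1 ER Ec2 Er' => [|p1 s] ER Ec2 Er'.
  by move: efy; case: ER => <- _; rewrite (negbTE rotated_f').
rewrite -rcons_cat cat_rcons in Er'.
have -> : prev c2 y = s.
  apply: (next_inj U2); rewrite next_prev // Ec2 -rcons_cat -rcons_cons cat_rcons.
  by rewrite next_cat // -cat_rcons rcons_cons rcons_cat -Ec2.
by have [_ +] := ins _ _ _ _ Er'; rewrite efy andbT.
Qed.

(** On [c2] the vertex [l] is a neighbour of [f] with successor [f'] and predecessor [b], and it
    misses all other successors and predecessors of neighbours of [f]; [miss_lt] leaves at most [k]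
    of each kind. The minimum degree then forces [w] to be among both kinds. *)
Lemma rotated_degree : nbh w \subset nbh f /\ #|nbh f| <= k.+1.
Proof.
have [efl elb _] := short_gap_edges; have M2 := rotated_maxcyc; have f2 := rotated_out.
have M2r := maxcyc_rev e_sym M2; have f2r : f \notin rev c2 by rewrite mem_rev.
have bw : b != w by apply: contraTneq bN => ->; apply: w_notin_nbh Mc xc.
have nl : next c2 l = f'.
  have Ec2 : c2 = (x :: rev (rcons r1 a')) ++ l :: f' :: r2.
    by rewrite /c2 /L rev_cons cat_rcons.
  by rewrite Ec2 next_cat // -Ec2.
have pl : prev c2 l = b.
  have [s Es] : exists s, rcons r1 a' = b :: s.
    by case: r1 Er => [|q s] [Eb _]; [exists [::] | exists (rcons s a')]; rewrite Eb.
  apply: (next_inj U2); rewrite next_prev //.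
  have Ec2 : c2 = (x :: rev s) ++ b :: l :: f' :: r2.
    by rewrite /c2 /L Es !rev_cons !cat_rcons.
  by rewrite Ec2 next_cat // -Ec2.
have lf : l \in nbh f by rewrite inE.
have yc2 y : y \in nbh f -> y \in c2 by apply: nbh_sub.
have [h1 h2] : #|real_succs c2 f| <= k /\ #|real_succs (rev c2) f| <= k.
  split.
    have f'S : f' \in real_succs c2 f.
      by rewrite in_setD1 f'w; apply/imsetP; exists l.
    have lH : l \notin indep_hull c2 f.
      by rewrite indep_hullP //; apply/existsP; exists f'; rewrite f'S.
    rewrite (cardsD1 f') f'S; apply: leq_ltn_trans (miss_lt M2 f2 lw lH).
    apply: subset_leq_card; apply/subsetP => s /setD1P[sf' sS].
    rewrite in_setD (subsetP (real_succs_sub M2 f2)) // andbT inE.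
    have [_ /imsetP[y yN Es]] := setD1P sS; rewrite Es in sf' *.
    have efy : e f y by move: yN; rewrite inE.
    by have [+ _] := rotated_neighbours (yc2 _ yN) efy; apply.
  have bS : b \in real_succs (rev c2) f.
    by rewrite in_setD1 bw; apply/imsetP; exists l; rewrite // next_rev.
  have lH : l \notin indep_hull (rev c2) f.
    by rewrite indep_hullP //; apply/existsP; exists b; rewrite bS.
  rewrite (cardsD1 b) bS; apply: leq_ltn_trans (miss_lt M2r f2r lw lH).
  apply: subset_leq_card; apply/subsetP => s /setD1P[sb sS].
  rewrite in_setD (subsetP (real_succs_sub M2r f2r)) // andbT inE.
  have [_ /imsetP[y yN Es]] := setD1P sS; rewrite next_rev // in Es; rewrite Es in sb *.
  have efy : e f y by move: yN; rewrite inE.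
  by have [_ +] := rotated_neighbours (yc2 _ yN) efy; apply.
have := deg_outsider M2 f2.
have := card_real_succs f M2; have := card_real_succs f M2r.
case w1: (w \in succs c2 f); case w2: (w \in succs (rev c2) f); rewrite /= => *; try by slia.
split; last by slia.
have [v' v'N Ev] := imsetP w1; have [u' u'N Eu] := imsetP w2.
rewrite next_rev // in Eu.
rewrite (nbh_w M2) subUset !sub1set {1}Eu {1}Ev next_prev // prev_next //.
by rewrite u'N v'N.
Qed.

End Rotated.

(** Otherwise [f] has five distinct neighbours: those of [w], its two cycle neighbours, and the last
    vertex of another gap. The bound k + 1 gives k at least 4, whereas the minimum degree gives k at
    most 3. *)
Lemma short_gap_start : last b r = next c w.
Proof.
have [a' [f' [r1 [r2 [Er xa' f'w elf']]]]] := short_gap_chord.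
have [nw degf] := rotated_degree Er xa' f'w elf'.
have [n1 n2 n3 _] := short_gap_next; have [efl elb eaf] := short_gap_edges.
have [fS lS fI lI] := short_gap_hulls; have [xf xl] := short_gap_out.
have [_ _ wc _ _] := Mc.
have Mr := maxcyc_rev e_sym Mc; have xr : x \notin rev c by rewrite mem_rev.
apply/eqP; apply: contraT => au.
pose u' := next c w; pose v' := prev c w.
have uv : u' != v'.
  by apply/eqP => E; have := next2_neq Mc wc; rewrite -/u' E next_prev // eqxx.
have nv : next c v' = w by rewrite next_prev.
have [u'f v'f] : u' \in nbh f /\ v' \in nbh f.
  by move: nw; rewrite (nbh_w Mc) subUset !sub1set => /andP[].
have := miss_succs Mr xr fw fI xf.
set D := finset _ => cD.
have [b' [b'D bb nb]] : exists b', [/\ b' \in D, b' != b & b' != next c u'].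
  have : 0 < #|D :\ b :\ next c u'|.
    have cr := real_succs_ge Mr xr; have dr := deg_outsider Mr xr.
    have cS := card_real_succs x Mr.
    (* If [w] precedes a neighbour of [x], that neighbour is [u'], so the vertex after [u'] is not
       one. Hence avoiding [next c u'] costs nothing beyond the loss already caused by [w]. *)
    have h : (w \in succs (rev c) x) + (next c u' \in D) <= 1.
      case w1: (w \in _) => //=; rewrite ?leq_b1 //.
      have [y yN Ey] := imsetP w1; rewrite next_rev // in Ey.
      have yu : y = u' by rewrite /u' Ey next_prev.
      by rewrite in_set -yu (negbTE (nbh_next Mc xc yN)).
    move: cD; rewrite (cardsD1 b D) (cardsD1 (next c u') (D :\ b)) in_setD1.
    move: h cS; case: (b \in D); case: (next c u' \in D); case: (w \in _);
      case: (_ != b) => /=; slia.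
  by case/card_gt0P => b'; rewrite !in_setD1 => /and3P[? ? ?]; exists b'.
move: b'D; rewrite in_set next_rev // => /and3P[b'N lmw flm].
set lm := prev c b' in lmw flm.
have nlm : next c lm = b' by rewrite next_prev.
have uq : uniq [:: last b r; l; lm; u'; v'].
  rewrite /= !inE !negb_or uv !andbT; apply/and3P; split.
  - apply/and4P; split=> //.
    + by apply: contraTneq aN => ->; rewrite inE xl.
    + apply: contraTneq b'N => E; rewrite -nlm -E n3; rewrite inE; exact: xf.
    + by apply: contraNneq fw => E; rewrite -n3 E nv.
  - apply/and3P; split.
    + by apply: contraNneq bb => E; rewrite -nlm -E n2.
    + apply: contraNneq fw => E; apply/eqP; apply: (next_inj Uc).
      by rewrite n1 E.
    + apply: contraTneq bN => E; rewrite -n2 E nv; exact: w_notin_nbh Mc xc.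
  - apply/andP; split.
    + by apply: contraNneq nb => E; rewrite -nlm E.
    + apply: contraTneq b'N => E; rewrite -nlm E nv; exact: w_notin_nbh Mc xc.
have : 5 <= #|nbh f|.
  rewrite cardE; apply: (uniq_leq_size uq) => y; rewrite mem_enum !inE.
  case/or4P => [/eqP->|/eqP->|/eqP->|/orP[] /eqP->] //.
  - by rewrite e_sym.
  - by move: u'f; rewrite inE.
  - by move: v'f; rewrite inE.
have := deg_outsider (rotated_maxcyc Er xa' elf') (rotated_out Er); slia.
Qed.

End ShortGap.

(** Applied in both directions, [short_gap_start] places the two-vertex gap between the neighbours
    of [w], so the cycle has five vertices. Only [a] and [b] can then be neighbours of [y], but its
    degree is at least 3. *)
Lemma maxcyc_spanning c y : maxcyc c -> y \in c.
Proof.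
move=> Mc; apply: contraT => yc; exfalso.
have [a [aN fw lw bN]] := exists_short_gap Mc yc.
have start d s : maxcyc d -> y \notin d -> s \in nbh y -> next d s != w ->
    next d (next d s) != w -> next d (next d (next d s)) \in nbh y -> s = next d w.
  move=> Md yd sN h1 h2 h3; have [Ud _ _ Sd _] := Md.
  have [i [Mi yi El E0]] := rot_at Md yd (nbh_sub Md yd sN).
  rewrite -(next_rot i Ud); have nx := next_rot i Ud.
  rewrite -!nx in h1 h2 h3 E0.
  move: (rot i d) Mi yi El E0 h1 h2 h3 {nx} => d' Mi yi El E0.
  have [Ui _ _ Si _] := Mi.
  have E1 : nth w d' 1 = next d' (next d' s) by rewrite -E0 next_nth_succ //; slia.
  have E2 : nth w d' 2 = next d' (next d' (next d' s)).
    by rewrite -E1 next_nth_succ.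
  rewrite -E2 -E1 -E0 => h1 h2 h3.
  have Ed : d' = [:: nth w d' 0, nth w d' 1, nth w d' 2 & drop 3 d'].
    by case: d' Si {Mi yi El E0 Ui E1 E2 h1 h2 h3} => [|? [|? [|? ?]]] //= _; rewrite drop0.
  have El' : last (nth w d' 2) (drop 3 d') = s.
    by rewrite -El nth_last [in RHS]Ed.
  by rewrite -{1}El'; apply: (short_gap_start Mi yi Ed) => //; rewrite El'.
have [Uc _ Wc _ _] := Mc.
have Mr := maxcyc_rev e_sym Mc; have yr : y \notin rev c by rewrite mem_rev.
set f := next c a in fw lw bN; set l := next c f in lw bN; set b := next c l in bN.
have Ea : a = next c w by apply: start.
have Eb : next c b = w.
  have : b = next (rev c) w by apply: start; rewrite ?next_rev ?prev_next.
  by rewrite next_rev // => ->; rewrite next_prev.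
have orbit i : i < size c -> nth w (rot (index w c) c) i \in [:: w; a; f; l; b].
  have W0 : nth w (rot (index w c) c) 0 = w.
    by rewrite nth_cat size_drop subn_gt0 index_mem Wc nth_drop addn0 nth_index.
  elim: i => [_|i IH lt]; first by rewrite W0 mem_head.
  rewrite -next_nth_succ ?rot_uniq ?size_rot // next_rot //.
  have := IH (ltnW lt); rewrite !inE => /or4P[/eqP->|/eqP->|/eqP->|/orP[]/eqP->].
  - by rewrite -Ea eqxx orbT.
  - by rewrite eqxx !orbT.
  - by rewrite eqxx !orbT.
  - by rewrite eqxx !orbT.
  - by rewrite Eb eqxx.
have sub : nbh y \subset [set a; b].
  apply/subsetP => t tN; have tc := nbh_sub Mc yc tN.
  have := orbit (index t (rot (index w c) c)).
  rewrite -(size_rot (index w c)) index_mem mem_rot tc nth_index ?mem_rot // => /(_ isT).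
  rewrite !inE => /or4P[/eqP E|->//|/eqP E|/orP[/eqP E|->]]; rewrite ?orbT //.
  - by move: (w_notin_nbh Mc yc); rewrite -E tN.
  - by move: (nbh_next Mc yc aN); rewrite -/f -E tN.
  - by move: (nbh_next Mc yc tN); rewrite E -/b bN.
have := subset_leq_card sub; rewrite cards2; have := deg_outsider Mc yc.
by case: (a != b) => /=; slia.
Qed.

End Exterior.

(** * The auxiliary graph with the new vertex [None] *)

Section Apex.
Variables (T : finType) (e : rel T) (u v : T).

Definition apex_rel : rel (option T) := fun p q =>
  match p, q with
  | Some x, Some y => e x y
  | None, Some y | Some y, None => (y == u) || (y == v)
  | None, None => false
  end.

Lemma apex_sym : symmetric e -> symmetric apex_rel.
Proof. by move=> es [x|] [y|] //=; rewrite es. Qed.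

Lemma apex_irr : irreflexive e -> irreflexive apex_rel.
Proof. by move=> ei [x|] //=; rewrite ei. Qed.

Lemma apex_degree : #|nbh apex_rel None| <= 2.
Proof.
have sub : nbh apex_rel None \subset [set Some u; Some v].
  by apply/subsetP => -[y|]; rewrite !inE.
by apply: leq_trans (subset_leq_card sub) _; rewrite cards2; case: (_ != _).
Qed.

Definition unlift_set (J : {set option T}) : {set T} := [set t | Some t \in J].

Lemma card_unlift_set (J : {set option T}) : None \notin J -> #|unlift_set J| = #|J|.
Proof.
move=> nJ; rewrite -(card_imset (mem (unlift_set J)) Some_inj).
apply: eq_card => -[t|]; last first.
  by rewrite (negbTE nJ); apply/negP => /imsetP[].
apply/imsetP/idP => [[s sJ [->]]|tJ]; first by rewrite inE in sJ.
by exists t; rewrite ?inE.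
Qed.

Lemma subset_of_card (A : {set T}) k : k <= #|A| -> exists2 B : {set T}, B \subset A & #|B| = k.
Proof.
move=> kA; exists [set y in take k (enum A)].
  by apply/subsetP => y; rewrite inE => /mem_take; rewrite mem_enum.
rewrite cardsE (card_uniqP _) ?take_uniq ?enum_uniq //.
by rewrite size_takel // -cardE.
Qed.

Lemma apex_free k : K2_kK1_free k e ->
  forall (y z : option T) (J : {set option T}), y != None -> z != None -> None \notin J ->
  apex_rel y z -> y \notin J -> z \notin J -> {in J &, forall a b, ~~ apex_rel a b} ->
  {in J, forall a, ~~ apex_rel y a /\ ~~ apex_rel z a} -> #|J| < k.
Proof.
move=> fr [y|] // [z|] // J _ _ nJ eyz yJ zJ iJ aJ; rewrite ltnNge; apply/negP => kJ.
rewrite -card_unlift_set // in kJ; have [B sB cB] := subset_of_card kJ.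
have BJ t : t \in B -> Some t \in J by move/(subsetP sB); rewrite inE.
apply: fr; exists y, z, B; split=> //.
- by apply: contra yJ => /BJ.
- by apply: contra zJ => /BJ.
split; last by move=> t /BJ/aJ.
by apply/forall_inP => s sB'; apply/forall_inP => t tB; apply: (iJ (Some s) (Some t)); apply: BJ.
Qed.

(** If [H] had at most [k] outside neighbours, deleting them would leave [t] reachable from [H],
    although no path can leave [H] without meeting a deleted vertex. *)
Lemma apex_conn k : k_connected k.+1 e -> forall H : {set option T}, None \notin H -> H != set0 ->
  (exists t, [/\ t != None, t \notin H & {in H, forall h, ~~ apex_rel h t}]) ->
  k < #|[set t | [&& t \notin H, t != None & [exists h in H, apex_rel h t]]]|.
Proof.
move=> [_ con] H nH /set0Pn[[h|] hH]; last by rewrite hH in nH.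
move=> [[t|] [tn tH ht]] //.
set A := finset _; rewrite ltnNge; apply/negP => cA.
have nA : None \notin A by rewrite inE /= andbF.
have := con (unlift_set A); rewrite card_unlift_set // ltnS => /(_ cA h t).
have hA : h \notin unlift_set A by rewrite !inE hH.
have tA : t \notin unlift_set A.
  rewrite !inE tH /=; apply/negP => /existsP[g /andP[gH egt]].
  by move: (ht _ gH); rewrite egt.
move=> /(_ hA tA)/connectP[p pp Et]; move: tH; rewrite Et.
elim: p h hH pp {hA Et} => [|y p IH] h hH /=; first by rewrite hH.
move=> /andP[/and3P[ehy _ yA] pp]; apply: IH pp.
apply: contraR yA => yH; rewrite !inE yH /=.
by apply/existsP; exists (Some h); rewrite hH.
Qed.

(** A path from [u] to [v] closes up through [None] to a cycle with at least three vertices, and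
    lengths are bounded by the number of vertices. *)
Lemma apex_maxcyc : k_connected 1 e -> u != v ->
  exists c, maxcyc apex_rel None c.
Proof.
move=> [_ con] uv.
pose P n := [exists t : n.-tuple (option T), [&& uniq t, cycle apex_rel t & None \in val t]].
have Pb n : P n -> n <= #|{: option T}|.
  case/existsP => t /and3P[ut _ _]; rewrite -(size_tuple t) -(card_uniqP ut).
  exact: max_card.
have Pc (c : seq (option T)) : uniq c -> cycle apex_rel c -> None \in c -> P (size c).
  by move=> uc cc nc; apply/existsP; exists (in_tuple c); rewrite /= uc cc nc.
have [n3 n3g P3] : exists2 n, 2 < n & P n.
  have := con set0; rewrite cards0 => /(_ isT u v).
  rewrite !in_set0 => /(_ isT isT)/connectP[p0 /shortenP[p pp up _] Ev].
  exists (size (None :: map Some (u :: p))).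
    by case: p Ev {pp up} => // Ev; rewrite Ev eqxx in uv.
  apply: Pc; rewrite ?inE //.
    rewrite cons_uniq map_inj_uniq ?up ?andbT; last exact: Some_inj.
    by apply/negP => /mapP[].
  rewrite /= eqxx rcons_path last_map -Ev /= eqxx orbT andbT path_map.
  by apply: sub_path pp => a b /=; rewrite !in_set0 !andbT.
have exP : exists n, P n by exists n3.
case: (ex_maxnP exP Pb) => m Pm max.
have /existsP[t /and3P[ut ct nt]] := Pm.
exists t; split=> //; rewrite size_tuple.
  by apply: leq_trans (max _ P3).
by move=> c uc cc nc; apply: max; apply: Pc.
Qed.

Lemma apex_hamiltonian (c : seq (option T)) : symmetric e ->
  maxcyc apex_rel None c -> (forall y, y \in c) ->
  exists p, [/\ path e u p, last u p = v, uniq (u :: p) & forall w, w \in u :: p].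
Proof.
move=> es [uc cc nc sc _] all_c.
have [i P Ei] := rot_to nc.
have EP (s : seq (option T)) : None \notin s -> s = map Some (pmap id s).
  by elim: s => //= -[y|] s IH //; rewrite inE => /= /IH {1}->.
have UP : uniq (None :: P) by rewrite -Ei rot_uniq.
have CP : cycle apex_rel (None :: P) by rewrite -Ei rot_cycle.
have sP : 2 < size (None :: P) by rewrite -Ei size_rot.
have memP t : Some t \in P.
  by have := all_c (Some t); rewrite -(mem_rot i c) Ei inE.
have nP : None \notin P by case/andP: UP.
move: UP CP sP memP; rewrite (EP _ nP); move: (pmap id P) => [|y s] //= UP CP sP memP.
have Us : uniq (y :: s).
  rewrite -(map_inj_uniq Some_inj); by case/andP: UP.
have mem_s t : t \in y :: s by rewrite -(mem_map Some_inj) memP.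
move: CP; rewrite rcons_path path_map last_map /= => /and3P[y_uv pys l_uv].
have ne : last y s != y.
  case: s sP Us {UP memP mem_s pys l_uv} => // a s _ /andP[yas _].
  by apply: contraNneq yas => <-; exact: (mem_last a s).
case/orP: y_uv => /eqP Ey; case/orP: l_uv => /eqP El; rewrite ?El ?Ey ?eqxx // in ne.
  by exists s; rewrite -Ey; split.
(* The cycle may traverse [None] the other way, giving a path from [v] to [u] that has to be
   reversed. *)
have Er : rev (y :: s) = u :: rev (belast y s) by rewrite lastI El rev_rcons.
have Ur : uniq (u :: rev (belast y s)) by rewrite -Er rev_uniq.
exists (rev (belast y s)); split=> //.
- by rewrite -El rev_path (@eq_path _ _ e) // => a b; rewrite /= es.
- case: s El {Er Ur UP sP memP Us mem_s pys} => [|a s] /= El; first by rewrite -Ey El.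
  by rewrite rev_cons last_rcons.
- by move=> t; rewrite -Er mem_rev.
Qed.

End Apex.

(** * Transfer of the hypotheses and conclusion *)

Lemma mindeg_le (T : finType) (e : rel T) x : mindeg e <= deg e x.
Proof.
rewrite /mindeg; have : x \in index_enum T by apply: mem_index_enum.
elim: (index_enum T) => // y r IH; rewrite inE big_cons => /orP[/eqP<-|/IH le].
  exact: geq_minl.
by apply: leq_trans le; apply: geq_minr.
Qed.

Theorem theorem1p9 (T : finType) (e : rel T) (k : nat) :
  simple_graph e ->
  2 <= k ->
  k_connected k.+1 e ->
  K2_kK1_free k e ->
  3 * k - 1 <= 2 * mindeg e ->
  2 * alpha e < #|T| ->
  hamiltonian_connected e.
Proof.
move=> [es ei] k2 con fr md al u v uv.
have con1 : k_connected 1 e.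
  by case: con => lt con; split=> [|S cS]; [lia | apply: con; lia].
have [c Mc] := apex_maxcyc con1 uv.
apply: (apex_hamiltonian es Mc) => y.
apply: (maxcyc_spanning (apex_sym u v es) (apex_irr u v ei) (apex_degree e u v)
  (apex_free (u := u) (v := v) fr) (apex_conn (u := u) (v := v) con) k2 _ _ _ Mc).
- move=> [x|] // _; apply: leq_trans md _; rewrite leq_pmul2l //.
  apply: leq_trans (mindeg_le e x) _; rewrite /deg -(card_imset _ Some_inj).
  apply: subset_leq_card; apply/subsetP => _ /imsetP[t + ->]; rewrite !inE /= => ->.
  by [].
- move=> J nJ iJ; rewrite card_option /=; apply: leq_ltn_trans al.
  rewrite leq_pmul2l // -(card_unlift_set nJ); apply: leq_bigmax_cond.
  apply/forall_inP => s; rewrite inE => sJ; apply/forall_inP => t; rewrite inE => tJ.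
  exact: (iJ (Some s) (Some t)).
Qed.
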